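(* Let $\zeta\ge0$ and let $F=F(\rho,q):\mathbb R^+\times\mathbb R^d\to\mathbb R$ be smooth. Let $(\rho,u)$ and $(\bar\rho,\bar u)$ be two smooth solutions, with positive densities, on $\mathbb T^d$ of the Euler--Korteweg system with friction $$\frac{\partial\rho}{\partial t}+\operatorname{div}(\rho u)=0,\qquad \rho\Big[\frac{\partial u}{\partial t}+(u\cdot\nabla)u\Big]=-\rho\nabla\big(F_\rho(\rho,\nabla\rho)-\nabla\cdot F_q(\rho,\nabla\rho)\big)-\zeta\rho u .$$ Then \begin{align*} &\frac{d}{dt}\int\Big(F(\rho,\nabla\rho\,|\,\bar\rho,\nabla\bar\rho)+\tfrac12\rho|u-\bar u|^2\Big)dx+\zeta\int\rho|u-\bar u|^2\,dx\\ &\quad=-\int\Big[(\operatorname{div}\bar u)\,s(\rho,\nabla\rho\,|\,\bar\rho,\nabla\bar\rho)+\nabla(\operatorname{div}\bar u)\cdot r(\rho,\nabla\rho\,|\,\bar\rho,\nabla\bar\rho)+\nabla\bar u:H(\rho,\nabla\rho\,|\,\bar\rho,\nabla\bar\rho)\Big]dx\\ &\qquad-\int\rho\,\nabla\bar u:(u-\bar u)\otimes(u-\bar u)\,dx . \end{align*}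
   Context: $\mathbb T^d$ is the flat torus and integrals are over $\mathbb T^d$. Conventions: $(\nabla\bar u)_{ij}=\partial\bar u_i/\partial x_j$, $A:B=\sum_{i,j}A_{ij}B_{ij}$, $(a\otimes b)_{ij}=a_ib_j$; $F_\rho,F_q$ denote partial derivative/gradient of $F(\rho,q)$. Define $$s(\rho,q)=\rho F_\rho(\rho,q)+q\cdot F_q(\rho,q)-F(\rho,q),\qquad r(\rho,q)=\rho F_q(\rho,q),\qquad H(\rho,q)=q\otimes F_q(\rho,q).$$ For a scalar-, vector- or matrix-valued function $g(\rho,q)$ (such as $F,s,r,H$) the relative function is, componentwise, $$g(\rho,q\,|\,\bar\rho,\bar q)=g(\rho,q)-g(\bar\rho,\bar q)-g_\rho(\bar\rho,\bar q)(\rho-\bar\rho)-g_q(\bar\rho,\bar q)\cdot(q-\bar q).$$ *)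

(* Defs.v *)
(* MathComp-Analysis; the reals are an arbitrary [R : realType]. *)
From HB Require Import structures.
From mathcomp Require Import all_boot all_order all_algebra.
From mathcomp Require Import all_classical all_reals all_analysis.

Set Implicit Arguments.
Unset Strict Implicit.
Unset Printing Implicit Defensive.

Import Order.TTheory GRing.Theory Num.Theory.
Import numFieldNormedType.Exports.

Local Open Scope classical_set_scope.
Local Open Scope ring_scope.

(* [smooth_on D f]: f is infinitely differentiable on the open set D.  In finite
   dimension, the (Frechet) derivative of f is n times differentiable if and
   only if all the directional derivatives ['D_v f] are, hence the recursion. *)
Fixpoint differentiable_upto {R : realType} {V W : normedModType R} (n : nat)
    (D : set V) (f : V -> W) : Prop :=
  (forall x, D x -> differentiable f x) /\
  (if n is n'.+1 then forall v : V, differentiable_upto n' D ('D_v f) else True).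

Definition smooth_on {R : realType} {V W : normedModType R}
    (D : set V) (f : V -> W) : Prop :=
  forall n, differentiable_upto n D f.

(* The flat torus is R^d / Z^d: a function on it is a function on R^d that is
   1-periodic in every coordinate. *)
Definition periodic {R : realType} {d : nat} {W : Type}
    (f : 'rV[R]_d -> W) : Prop :=
  forall (i : 'I_d) (x : 'rV[R]_d), f (x + delta_mx 0 i) = f x.

(* The integral over the torus, as the iterated Lebesgue integral over the unit
   cube [0, 1]^d.  By Fubini, for continuous integrands this is the integral
   for the d-dimensional Lebesgue measure. *)
Fixpoint torus_integral {R : realType} {d : nat} : ('rV[R]_d -> R) -> R :=
  match d with
  | 0%N => fun f => f 0
  | d'.+1 => fun f =>
      \int[lebesgue_measure]_(s in `[0, 1])
        torus_integral
          (fun y : 'rV[R]_d' => f (row_mx (const_mx s : 'rV[R]_1) y))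
  end.

Section VectorCalculus.
Context {R : realType} {d : nat}.
Implicit Types (a b x q qb : 'rV[R]_d) (A B : 'M[R]_d).

Definition dot a b : R := \sum_i a 0 i * b 0 i.
Definition frob A B : R := \sum_i \sum_j A i j * B i j.
Definition outer a b : 'M[R]_d := \matrix_(i, j) (a 0 i * b 0 j).

Definition partial (i : 'I_d) (f : 'rV[R]_d -> R) x : R :=
  'D_(delta_mx 0 i) f x.

Definition grad (f : 'rV[R]_d -> R) x : 'rV[R]_d := \row_i partial i f x.

Definition divergence (v : 'rV[R]_d -> 'rV[R]_d) x : R :=
  \sum_i partial i (fun y => v y 0 i) x.

(* (grad_vec v)_ij = d v_i / d x_j: this is the transpose of the library's
   Jacobian ['J v x], which acts on row vectors. *)
Definition grad_vec (v : 'rV[R]_d -> 'rV[R]_d) x : 'M[R]_d :=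
  \matrix_(i, j) partial j (fun y => v y 0 i) x.

(* (v . nabla) w *)
Definition advection (v w : 'rV[R]_d -> 'rV[R]_d) x : 'rV[R]_d :=
  \row_i \sum_j v x 0 j * partial j (fun y => w y 0 i) x.

Implicit Types (rho rhob : R) (F g : R -> 'rV[R]_d -> R).

Definition D_rho g rho q : R := derive1 (fun r => g r q) rho.
Definition D_q g rho q : 'rV[R]_d := grad (g rho) q.

(* g(rho, q | rhob, qb) *)
Definition relative g rho q rhob qb : R :=
  g rho q - g rhob qb
  - D_rho g rhob qb * (rho - rhob) - dot (D_q g rhob qb) (q - qb).

Definition relative_vec (g : R -> 'rV[R]_d -> 'rV[R]_d)
    rho q rhob qb : 'rV[R]_d :=
  \row_i relative (fun r p => g r p 0 i) rho q rhob qb.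

Definition relative_mx (g : R -> 'rV[R]_d -> 'M[R]_d)
    rho q rhob qb : 'M[R]_d :=
  \matrix_(i, j) relative (fun r p => g r p i j) rho q rhob qb.

Definition s_fun F rho q : R :=
  rho * D_rho F rho q + dot q (D_q F rho q) - F rho q.

Definition r_fun F rho q : 'rV[R]_d := rho *: D_q F rho q.

Definition H_fun F rho q : 'M[R]_d := outer q (D_q F rho q).

(* F_rho(rho, grad rho) - div F_q(rho, grad rho), for a density [rho] at a fixed
   time *)
Definition chemical_potential F (rho : 'rV[R]_d -> R) x : R :=
  D_rho F (rho x) (grad rho x)
  - divergence (fun y => D_q F (rho y) (grad rho y)) x.

End VectorCalculus.

(* Smooth solution with positive density, on the torus, for times in the open
   interval [I]; the values of [rho] and [u] at other times are irrelevant. *)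
Record EK_solution {R : realType} {d : nat} (zeta : R)
    (F : R -> 'rV[R]_d -> R) (I : set R)
    (rho : R -> 'rV[R]_d -> R) (u : R -> 'rV[R]_d -> 'rV[R]_d) : Prop := {
  EK_rho_smooth :
    smooth_on [set p : R * 'rV[R]_d | I p.1] (fun p => rho p.1 p.2) ;
  EK_u_smooth :
    smooth_on [set p : R * 'rV[R]_d | I p.1] (fun p => u p.1 p.2) ;
  EK_rho_periodic : forall t, I t -> periodic (rho t) ;
  EK_u_periodic : forall t, I t -> periodic (u t) ;
  EK_rho_gt0 : forall t x, I t -> 0 < rho t x ;
  EK_continuity : forall t x, I t ->
    derive1 (rho ^~ x) t + divergence (fun y => rho t y *: u t y) x = 0 ;
  EK_momentum : forall t x, I t ->
    rho t x *: (derive1 (u ^~ x) t + advection (u t) (u t) x)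
    = - (rho t x *: grad (chemical_potential F (rho t)) x)
      - (zeta * rho t x) *: u t x
}.

(* Main.v *)
Require Import Defs.
From HB Require Import structures.
From mathcomp Require Import all_boot all_order all_algebra.
From mathcomp Require Import ring.
From mathcomp Require Import all_classical all_reals all_analysis.

Set Implicit Arguments.
Unset Strict Implicit.
Unset Printing Implicit Defensive.

Import Order.TTheory GRing.Theory Num.Theory.
Import numFieldNormedType.Exports.

Local Open Scope classical_set_scope.
Local Open Scope ring_scope.

(** The proof exhibits an explicit energy flux: the identity holds pointwise in
space-time up to the divergence of a periodic smooth field, and the integral of
such a divergence over the torus vanishes.

Write q = grad rho, qb = grad rhob, w = u - ub, and let s_F be the relative
energy density F(rho, q | rhob, qb).  Put a = F_rho(rho, q) - F_rho(rhob, qb),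
b = F_q(rho, q) - F_q(rhob, qb), and let X, Y be the derivatives of F_rho, F_q
at (rhob, qb) in the direction (rho - rhob, q - qb).  Everything rests on two
facts.

- Because the Hessian of F is symmetric, every directional derivative of s_F is
  a D(rho) + b . D(q) - X D(rhob) - Y . D(qb)  [derive_relative_density].
- For any density rho, velocity field ub and coefficients a, b, the quantity
  a m + b . grad m with m = div (rho ub) splits into the three contractions
  with div ub, grad (div ub) and grad ub that define the stress, plus the
  transport term ub . (a grad rho + b . grad q)  [transport_identity].

The relative functions of s, r and H are exactly the differences of those
contractions for (a, b, rho) and for (X, Y, rhob), up to s_F
[relative_s_expand, relative_r_expand, relative_H_expand].  So, using the two
continuity equations, the time derivative of s_F plus the relative stress is
minus the divergence of  s_F ub + c b + (mu - mub) rho w,  with c = div (rho w)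
and mu the chemical potential, plus the work rho w . grad (mu - mub)
[internal_balance].  The momentum equations give the kinetic energy the
opposite work term, together with friction and the convective term
[kinetic_balance].  The sum of the two is energy_balance.

The torus integral is an iterated integral.  Its continuity in a parameter, by
induction on the dimension, gives differentiation under the integral sign
[torus_integral_derive]; that and the fundamental theorem of calculus give the
vanishing of the integral of a partial derivative of a periodic function
[torus_integral_partial].  The relative stress is integrated through the
balance law, which writes it as a combination of smooth functions. *)

(** * Integrals over the unit interval depending on a parameter *)

Section UnitIntervalIntegral.
Context {R : realType}.
Implicit Types f g : R -> R.

Let mu := @lebesgue_measure R.

Lemma continuous_integrable01 f : continuous f ->
  mu.-integrable `[0, 1] (EFin \o f).
Proof.
move=> cf; apply: continuous_compact_integrable; first exact: segment_compact.
exact: continuous_subspaceT.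
Qed.

Lemma Rintegral01_cst (r : R) : \int[mu]_(x in `[0, 1]) r = r.
Proof.
by rewrite Rintegral_cst//= /mu lebesgue_measure_itv/= lte_fin ltr01 -EFinD subr0 mulr1.
Qed.

Lemma Rintegral01_dist f g e : continuous f -> continuous g ->
  (forall s, `[0, 1]%classic s -> `|f s - g s| <= e) ->
  `|\int[mu]_(s in `[0, 1]) f s - \int[mu]_(s in `[0, 1]) g s| <= e.
Proof.
move=> cf cg fge.
have cfg : continuous (fun s => f s - g s).
  by move=> s; apply: continuousB; [exact: cf|exact: cg].
rewrite -RintegralB//; [|exact: continuous_integrable01..].
apply: (le_trans (le_normr_Rintegral _ _)) => //.
  exact: (continuous_integrable01 cfg).
rewrite -[leRHS]Rintegral01_cst; apply: le_Rintegral => //.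
- apply: (@continuous_integrable01 (fun s => `|f s - g s|)) => s.
  exact: (continuous_comp (cfg s) (@norm_continuous _ _ _)).
- by apply: continuous_integrable01 => s; exact: cvg_cst.
Qed.

Lemma continuous_curry_pt (P Q : topologicalType) (f : P -> Q -> R) (p : P) :
  (forall s, {for (p, s), continuous (fun z : P * Q => f z.1 z.2)}) ->
  continuous (f p).
Proof.
move=> cf s.
apply: (@cvg_comp _ _ _ (fun s' => (p, s')) (fun z => f z.1 z.2) _ _ _ _ (cf s)).
by apply: cvg_pair => /=; [exact: cvg_cst|exact: cvg_id].
Qed.

(** Compactness of the unit interval makes the convergence of the slices uniform:
this is the tube lemma, in the form of near coverings. *)
Lemma continuous_parameter01 (P : topologicalType) (D : set P)
    (f : P -> R -> R) : open D ->
  (forall p s, D p -> {for (p, s), continuous (fun z : P * R => f z.1 z.2)}) ->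
  forall p, D p ->
    {for p, continuous (fun q => \int[mu]_(s in `[0, 1]) f q s)}.
Proof.
move=> oD cf p Dp.
apply/cvgrPdist_le => e e0.
have near_le : \forall q \near p,
    `[0, 1]%classic `<=` (fun s => `|f p s - f q s| <= e).
  apply: ((compact_near_coveringP _).1 (@segment_compact R 0 1)).
  move=> s _.
  have e20 : 0 < e / 2 by rewrite divr_gt0.
  have /cvgrPdist_lt /(_ _ e20) := cf p s Dp.
  move=> [[U V] [/= nU nV] UV]; exists (V, U) => //= -[s' q] /= [Vs' Uq].
  have h1 := UV (q, s') (conj Uq Vs').
  have h2 := UV (p, s') (conj (nbhs_singleton nU) Vs').
  rewrite -(subrKA (f p s)) (splitr e) (le_trans (ler_normD _ _))// lerD//.
    by rewrite distrC ltW.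
  by rewrite ltW.
near=> q.
have Dq : D q by near: q; exact: open_nbhs_nbhs.
apply: Rintegral01_dist.
- exact: continuous_curry_pt (cf p ^~ Dp).
- exact: continuous_curry_pt (cf q ^~ Dq).
- by near: q.
Unshelve. all: by end_near. Qed.

End UnitIntervalIntegral.

(** * Linearity and continuity of the torus integral *)

Section TorusIntegral.
Context {R : realType}.

Lemma continuous_fst (P Q : topologicalType) : continuous (@fst P Q).
Proof. by move=> [a b]; exact: cvg_fst. Qed.

Lemma continuous_snd (P Q : topologicalType) : continuous (@snd P Q).
Proof. by move=> [a b]; exact: cvg_snd. Qed.

Lemma continuous_scale (P : topologicalType) (c : R) (g : P -> R) :
  continuous g -> continuous (fun x => c * g x).
Proof. by move=> cg x; apply: cvgM; [exact: cvg_cst|exact: cg]. Qed.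

Lemma continuous_add (P : topologicalType) (f g : P -> R) :
  continuous f -> continuous g -> continuous (fun x => f x + g x).
Proof. by move=> cf cg x; apply: cvgD; [exact: cf|exact: cg]. Qed.

(** The topology of matrices is the product topology, and the index set is finite. *)
Lemma cvg_row (T : Type) (F : set_system T) {FF : Filter F} n
    (g : T -> 'rV[R]_n) (l : 'rV[R]_n) :
  (forall i, g t 0 i @[t --> F] --> l 0 i) -> g t @[t --> F] --> l.
Proof.
move=> gl A [Q nQ QA].
have : \forall t \near F, forall i, Q 0 i (g t 0 i).
  by apply: filter_forall => i; apply: gl; exact: nQ.
apply: filterS => t Qt; apply: QA => i j.
by rewrite (ord1 i); exact: Qt.
Qed.

(** The argument that the recursive definition of the torus integral feeds to its
integrand. *)
Definition cons_row d (s : R) (y : 'rV[R]_d) : 'rV[R]_d.+1 :=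
  row_mx (const_mx s : 'rV[R]_1) y.

Lemma cons_row0 d s (y : 'rV[R]_d) : cons_row s y 0 0 = s.
Proof.
by rewrite mxE; case: splitP => [j _|j]; [rewrite mxE|].
Qed.

Lemma cons_row_lift d s (y : 'rV[R]_d) i : cons_row s y 0 (lift 0 i) = y 0 i.
Proof.
rewrite mxE; case: splitP => j /=; first by case: j => -[].
by rewrite /bump leq0n => /eqP; rewrite eqn_add2l => /eqP/val_inj ->.
Qed.

Lemma continuous_cons_row (P : topologicalType) d (z : (P * R) * 'rV[R]_d) :
  {for z, continuous (fun z : (P * R) * 'rV[R]_d =>
     (z.1.1, cons_row z.1.2 z.2))}.
Proof.
case: z => -[p s] y.
have h1 : (fun z : (P * R) * 'rV[R]_d => z.1.1) @ (p, s, y) --> p.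
  exact: (cvg_comp _ _ (@continuous_fst _ _ (p, s, y)) (@continuous_fst _ _ (p, s))).
have h2 : (fun z : (P * R) * 'rV[R]_d => cons_row z.1.2 z.2) @ (p, s, y)
    --> cons_row s y.
  apply: (cvg_row (FF := nbhs_filter _)) => i; case: (unliftP 0 i) => [j|] ->.
    under eq_fun do rewrite cons_row_lift.
    rewrite cons_row_lift.
    exact: (cvg_comp _ _ (@continuous_snd _ _ (p, s, y))
      (@coord_continuous _ _ _ 0 j y)).
  under eq_fun do rewrite cons_row0.
  rewrite cons_row0.
  exact: (cvg_comp _ _ (@continuous_fst _ _ (p, s, y)) (@continuous_snd _ _ (p, s))).
exact: (cvg_pair h1 h2).
Qed.

(** The parameter space is arbitrary so that the induction on the dimension can
absorb the first coordinate into the parameter. *)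
Lemma torus_integral_continuous_parameter d (P : topologicalType) (D : set P)
    (f : P -> 'rV[R]_d -> R) : open D ->
  (forall p y, D p ->
     {for (p, y), continuous (fun z : P * 'rV[R]_d => f z.1 z.2)}) ->
  forall p, D p -> {for p, continuous (fun q => torus_integral (f q))}.
Proof.
elim: d P D f => [|d IHd] P D f oD cf p Dp /=.
  have h1 : (fun q : P => q) @ p --> p by exact: cvg_id.
  have h2 : (fun=> 0 : 'rV[R]_0) @ p --> (0 : 'rV[R]_0) by exact: cvg_cst.
  exact: (@cvg_comp _ _ _ (fun q => (q, 0)) (fun z => f z.1 z.2) _ _ _
    (cvg_pair h1 h2) (cf p 0 Dp)).
apply: (continuous_parameter01 (D := D)) => // q s Dq.
apply: (IHd (P * R)%type (fst @^-1` D)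
  (fun z y => f z.1 (cons_row z.2 y))) => //.
  by apply: open_comp => // z _; exact: (@continuous_fst _ _ z).
move=> z y Dz.
apply: (@cvg_comp _ _ _ (fun z : (P * R) * 'rV[R]_d =>
     (z.1.1, cons_row z.1.2 z.2)) (fun z => f z.1 z.2) _ _ _
     (@continuous_cons_row _ _ (z, y))).
exact: cf.
Qed.

Lemma continuous_slice d (f : 'rV[R]_d.+1 -> R) (s : R) : continuous f ->
  continuous (fun y => f (cons_row s y)).
Proof.
move=> cf y.
have h : cons_row s @ y --> cons_row s y.
  apply: (cvg_row (FF := nbhs_filter _)) => i; case: (unliftP 0 i) => [j|] ->.
    under eq_fun do rewrite cons_row_lift.
    rewrite cons_row_lift; exact: coord_continuous.
  by under eq_fun do rewrite cons_row0; rewrite cons_row0; exact: cvg_cst.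
exact: (cvg_comp _ _ h (cf _)).
Qed.

Lemma continuous_joint_slice d (f : 'rV[R]_d.+1 -> R) (s : R) (y : 'rV[R]_d) :
  continuous f ->
  {for (s, y), continuous (fun z : R * 'rV[R]_d => f (cons_row z.1 z.2))}.
Proof.
move=> cf.
have h : (fun z : R * 'rV[R]_d => cons_row z.1 z.2) @ (s, y) --> cons_row s y.
  apply: (cvg_row (FF := nbhs_filter _)) => i; case: (unliftP 0 i) => [j|] ->.
    under eq_fun do rewrite cons_row_lift.
    rewrite cons_row_lift.
    exact: (cvg_comp _ _ (@continuous_snd _ _ (s, y))
      (@coord_continuous _ _ _ 0 j y)).
  under eq_fun do rewrite cons_row0.
  by rewrite cons_row0; exact: (@continuous_fst _ _ (s, y)).
exact: (cvg_comp _ _ h (cf _)).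
Qed.

Lemma torus_integral_slice_continuous d (f : 'rV[R]_d.+1 -> R) :
  continuous f ->
  continuous (fun s => torus_integral (fun y => f (cons_row s y))).
Proof.
move=> cf s.
apply: (torus_integral_continuous_parameter
  (f := fun s y => f (cons_row s y)) openT) => // {}s y _.
exact: continuous_joint_slice.
Qed.

Lemma torus_integralD d (f g : 'rV[R]_d -> R) : continuous f -> continuous g ->
  torus_integral (fun x => f x + g x) = torus_integral f + torus_integral g.
Proof.
elim: d f g => [//|d IHd] f g cf cg /=.
rewrite -RintegralD//; last 2 first.
- exact/continuous_integrable01/torus_integral_slice_continuous.
- exact/continuous_integrable01/torus_integral_slice_continuous.
apply: eq_Rintegral => s _; apply: (IHd (fun y => f (cons_row s y))).
  exact: continuous_slice.
exact: continuous_slice.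
Qed.

Lemma torus_integralZ d (c : R) (f : 'rV[R]_d -> R) : continuous f ->
  torus_integral (fun x => c * f x) = c * torus_integral f.
Proof.
elim: d f => [//|d IHd] f cf /=.
rewrite -RintegralZl//; last first.
  exact/continuous_integrable01/torus_integral_slice_continuous.
apply: eq_Rintegral => s _; apply: (IHd (fun y => f (cons_row s y))).
exact: continuous_slice.
Qed.

Lemma torus_integralB d (f g : 'rV[R]_d -> R) : continuous f -> continuous g ->
  torus_integral (fun x => f x - g x) = torus_integral f - torus_integral g.
Proof.
move=> cf cg; rewrite -mulN1r -torus_integralZ// -torus_integralD//.
  by congr torus_integral; apply/funext => x; rewrite mulN1r.
exact: continuous_scale.
Qed.

Lemma torus_integral0 d : torus_integral (fun _ : 'rV[R]_d => 0 : R) = 0.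
Proof.
elim: d => [//|d IHd] /=.
by under eq_Rintegral do rewrite IHd; rewrite Rintegral01_cst.
Qed.

Lemma torus_integral_sum d n (f : 'I_n -> 'rV[R]_d -> R) :
  (forall i, continuous (f i)) ->
  torus_integral (fun x => \sum_i f i x) = \sum_i torus_integral (f i).
Proof.
elim: n f => [|n IHn] f cf.
  rewrite big_ord0 -[RHS](torus_integral0 d).
  by congr torus_integral; apply/funext => x; rewrite big_ord0.
rewrite big_ord_recl -IHn// -torus_integralD//.
  by congr torus_integral; apply/funext => x; rewrite big_ord_recl.
apply: continuous_big => [z|i _]; [exact: add_continuous|exact: cf].
Qed.

End TorusIntegral.

(** * Differentiation and integration by parts on the torus *)

Section TorusCalculus.
Context {R : realType}.

(** A form of the mean value theorem that is insensitive to the sign of the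
increment h. *)
Lemma mean_value_line (f df : R -> R) (t h : R) :
  (forall s, `|s| <= `|h| -> is_derive (s + t) 1 f (df (s + t))) ->
  exists2 s, `|s| <= `|h| & f (h + t) - f t = h * df (s + t).
Proof.
move=> fdf.
have cf (a b : R) : `|a| <= `|h| -> `|b| <= `|h| ->
    {within `[a + t, b + t], continuous f}.
  move=> ah bh; apply: derivable_within_continuous => x.
  rewrite in_itv/= => /andP[ax xb].
  rewrite -(subrK t x); apply: (@ex_derive _ _ _ _ _ _ _ (fdf _ _)).
  move: ah bh; rewrite !ler_norml => /andP[ha _] /andP[_ hb].
  by rewrite lerBrDr lerBlDr (le_trans _ ax) ?lerD2r//= (le_trans xb)// lerD2r.
have dfx (a b : R) : `|a| <= `|h| -> `|b| <= `|h| -> forall x,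
    x \in `]a + t, b + t[%R -> is_derive x 1 f (df x).
  move=> ah bh x; rewrite in_itv/= => /andP[ax xb].
  rewrite -(subrK t x); apply: fdf.
  move: ah bh; rewrite !ler_norml => /andP[ha _] /andP[_ hb].
  rewrite lerBrDr lerBlDr (le_trans _ (ltW ax)) ?lerD2r//=.
  by rewrite (le_trans (ltW xb))// lerD2r.
have h0 : `|0 : R| <= `|h| by rewrite normr0.
have [h_ge0|h_lt0] := leP 0 h.
  have [|c] := MVT_segment _ (dfx 0 h h0 (lexx _)) (cf 0 h h0 (lexx _)).
    by rewrite lerD2r.
  rewrite add0r in_itv/= => /andP[tc ch] E; exists (c - t).
    by rewrite !ger0_norm ?subr_ge0// lerBlDr.
  by rewrite subrK E addrK mulrC.
have [|c] := MVT_segment _ (dfx h 0 (lexx _) h0) (cf h 0 (lexx _) h0).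
  by rewrite lerD2r ltW.
rewrite add0r in_itv/= => /andP[hc ct] E; exists (c - t).
  by rewrite ler0_norm ?subr_le0// (ltr0_norm h_lt0) lerN2 lerBrDr.
by rewrite subrK -opprB E; ring.
Qed.

(** The difference quotient, extended at increment 0 by the derivative, is jointly
continuous by the mean value theorem; hence its integral is continuous in the
increment, and its value at 0 is the derivative of the integral. *)
Lemma torus_integral_derive d (I : set R) (f df : R -> 'rV[R]_d -> R) :
  open I ->
  (forall t y, I t -> is_derive t 1 (f ^~ y) (df t y)) ->
  (forall t y, I t ->
    {for (t, y), continuous (fun z : R * 'rV[R]_d => f z.1 z.2)}) ->
  (forall t y, I t ->
    {for (t, y), continuous (fun z : R * 'rV[R]_d => df z.1 z.2)}) ->
  forall t, I t ->
    is_derive t 1 (fun t => torus_integral (f t)) (torus_integral (df t)).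
Proof.
move=> oI fdf cf cdf t It.
have /nbhs_ballP[r /= r0 rI] : nbhs t I by exact: open_nbhs_nbhs.
pose D := ball (0 : R) r.
have DI h : D h -> I (h + t).
  move=> Dh; apply: rI; move: Dh; rewrite /D/= /ball/= sub0r normrN => Dh.
  by rewrite opprD addrCA subrr addr0 normrN.
pose q h y := if h == 0 then df t y else h^-1 * (f (h + t) y - f t y).
have q_df h y : D h -> exists2 s, `|s| <= `|h| & q h y = df (s + t) y.
  move=> Dh; rewrite /q; case: eqP => [->|/eqP h0].
    by exists 0; rewrite ?normr0// add0r.
  have [|s sh E] := @mean_value_line (f ^~ y) (df ^~ y) t h.
    move=> s sh; apply/fdf/DI; move: Dh; rewrite /D/= /ball/= !sub0r !normrN.
    exact: le_lt_trans.
  by exists s => //; rewrite E mulKf.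
have cq h y : D h -> {for (h, y), continuous (fun z : R * 'rV[R]_d => q z.1 z.2)}.
  move=> Dh; have [h0|h0] := eqVneq h 0.
    apply/cvgrPdist_le => e e0; rewrite h0.
    have /cvgrPdist_le /(_ e e0)[[U W] [/= nU nW] UW] := cdf t y It.
    have /nbhs_ballP[k /= k0 kU] := nU.
    exists (D `&` ball 0 k, W) => /=.
      by split => //; apply: filterI; exact: nbhsx_ballx.
    move=> -[h' y'] [/= [Dh' kh'] Wy'].
    have [s sh ->] := q_df h' y' Dh'.
    rewrite /q eqxx; apply: (UW (s + t, y')); split => //=; apply: kU.
    move: kh'; rewrite /ball/= sub0r normrN => kh'.
    by rewrite opprD addrCA subrr addr0 normrN (le_lt_trans sh).
  pose g (z : R * 'rV[R]_d) := z.1^-1 * (f (z.1 + t) z.2 - f t z.2).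
  have gq : \forall z \near (h, y), g z = q z.1 z.2.
    exists ([set h' | h' != 0], setT) => /=.
      split; last exact: filterT.
      apply: open_nbhs_nbhs; split => //; exact: open_neq.
    by move=> -[h' y'] [/= h'0 _]; rewrite /q /g/= (negbTE h'0).
  have gE : g (h, y) = q h y by rewrite /g/q/= (negbTE h0).
  suff : (fun z : R * 'rV[R]_d => q z.1 z.2) @ (h, y) --> g (h, y) by rewrite gE.
  apply: cvg_trans; first exact: (near_eq_cvg gq).
  have c1 := @continuous_fst R 'rV[R]_d (h, y).
  have c2 := @continuous_snd R 'rV[R]_d (h, y).
  apply: cvgM; first exact: (cvgV _ c1).
  apply: cvgB.
    have h1 : (fun z : R * 'rV[R]_d => (z.1 + t)) @ (h, y) --> h + t.
      by apply: cvgD; [exact: c1|exact: cvg_cst].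
    exact: (cvg_comp (fun z : R * 'rV[R]_d => (z.1 + t, z.2))
      (fun z => f z.1 z.2) (cvg_pair h1 c2) (cf _ _ (DI _ Dh))).
  have h1 : (fun z : R * 'rV[R]_d => t) @ (h, y) --> t by exact: cvg_cst.
  exact: (cvg_comp (fun z : R * 'rV[R]_d => (t, z.2))
    (fun z => f z.1 z.2) (cvg_pair h1 c2) (cf _ _ It)).
have oD : open D by exact: ball_open.
have D0 : D 0 by exact: ballxx.
have Tq := torus_integral_continuous_parameter oD cq D0.
have q0 : q 0 = df t by apply/funext => y; rewrite /q eqxx.
have lim_quot : h^-1 *: (((fun t => torus_integral (f t)) \o shift t) (h *: 1)
     - torus_integral (f t)) @[h --> 0^'] --> torus_integral (df t).
  rewrite -q0.
  apply: cvg_trans (cvg_trans (cvg_app _ (@nbhs_dnbhs _ 0)) Tq).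
  apply: near_eq_cvg; near=> h.
  have Dh : D h by near: h; apply: nbhs_dnbhs; exact: open_nbhs_nbhs.
  have h0 : h != 0 by near: h; exact: nbhs_dnbhs_neq.
  have cft := continuous_curry_pt (fun y => cf t y It).
  have cfh := continuous_curry_pt (fun y => cf (h + t) y (DI h Dh)).
  rewrite /= [h *: 1]mulr1 -torus_integralB// -[RHS]torus_integralZ.
    by congr torus_integral; apply/funext => y; rewrite /q (negbTE h0).
  by move=> y; apply: continuousB; [exact: cfh|exact: cft].
apply: DeriveDef; first by apply/cvg_ex; exists (torus_integral (df t)).
exact: cvg_lim.
Unshelve. all: by end_near. Qed.

Lemma cons_row_shift0 d (s h : R) (y : 'rV[R]_d) :
  h *: delta_mx 0 0 + cons_row s y = cons_row (h + s) y.
Proof.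
apply/rowP => i; rewrite mxE [X in X + _]mxE [X in _ * X + _]mxE.
case: (unliftP 0 i) => [j|] ->.
  by rewrite !cons_row_lift /= mulr0 add0r.
by rewrite !cons_row0 mulr1.
Qed.

Lemma cons_row_shift_lift d (s h : R) (y : 'rV[R]_d) j :
  h *: delta_mx 0 (lift 0 j) + cons_row s y =
  cons_row s (h *: delta_mx 0 j + y).
Proof.
apply/rowP => i; rewrite mxE [X in X + _]mxE [X in _ * X + _]mxE.
case: (unliftP 0 i) => [k|] ->.
  by rewrite !cons_row_lift !mxE (inj_eq lift_inj).
by rewrite !cons_row0 (_ : (0 == lift 0 j) = false) ?andbF ?mulr0 ?add0r.
Qed.

Lemma derivative_slice_lift d (V : 'rV[R]_d.+1 -> R) s (y : 'rV[R]_d) j :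
  partial j (fun y => V (cons_row s y)) y =
    partial (lift 0 j) V (cons_row s y) /\
  (derivable V (cons_row s y) (delta_mx 0 (lift 0 j)) ->
   derivable (fun y => V (cons_row s y)) y (delta_mx 0 j)).
Proof.
rewrite /partial /derive /derivable.
set q := (fun h : R => _); set q' := (fun h : R => _).
suff -> : q = q' by [].
by apply/funext => h; rewrite /q /q' /= cons_row_shift_lift.
Qed.

Lemma derivative_slice0 d (V : 'rV[R]_d.+1 -> R) s (y : 'rV[R]_d) :
  derivable V (cons_row s y) (delta_mx 0 0) ->
  is_derive s 1 (fun s => V (cons_row s y)) (partial 0 V (cons_row s y)).
Proof.
move=> dV; suff : derivable (fun s => V (cons_row s y)) s 1 /\
    'D_1 (fun s => V (cons_row s y)) s = partial 0 V (cons_row s y).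
  by move=> [? ?]; exact: DeriveDef.
move: dV; rewrite /partial /derive /derivable.
set q := (fun h : R => _); set q' := (fun h : R => _).
suff -> : q' = q by [].
by apply/funext => h; rewrite /q /q' /= cons_row_shift0 [h *: 1]mulr1.
Qed.

(** For the first coordinate, differentiate under the inner integral and apply the
fundamental theorem of calculus: the boundary terms cancel by periodicity.  For
the others, the inner integral vanishes by induction. *)
Lemma torus_integral_partial d (V : 'rV[R]_d -> R) (i : 'I_d) :
  Defs.periodic V -> continuous V -> (forall x, derivable V x (delta_mx 0 i)) ->
  continuous (partial i V) -> torus_integral (partial i V) = 0.
Proof.
elim: d V i => [V []//|d IHd] V i pV cV dV cdV /=.
case: (unliftP 0 i) dV cdV => [j|] -> dV cdV.
  rewrite -[RHS](Rintegral01_cst (0 : R)); apply: eq_Rintegral.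
  move=> s _.
  have slice y := derivative_slice_lift V s y j.
  have dE : (fun y => partial (lift 0 j) V (cons_row s y)) =
      partial j (fun y => V (cons_row s y)).
    by apply/funext => y; rewrite (slice y).1.
  rewrite dE; apply: IHd.
  - move=> k y; rewrite -[RHS](pV (lift 0 k)) [y + _]addrC [in RHS]addrC.
    by have := cons_row_shift_lift s 1 y k; rewrite !scale1r => ->.
  - exact: continuous_slice.
  - by move=> y; exact: (slice y).2.
  - by rewrite -dE; exact: continuous_slice.
pose G s := torus_integral (fun y => V (cons_row s y)).
pose g s := torus_integral (fun y => partial 0 V (cons_row s y)).
have dG (s : R) : is_derive s 1 G (g s).
  apply: (torus_integral_derive (f := fun s y => V (cons_row s y))
    (df := fun s y => partial 0 V (cons_row s y)) openT) => //.
  - by move=> {}s y _; exact: derivative_slice0.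
  - by move=> {}s y _; exact: continuous_joint_slice.
  - by move=> {}s y _; exact: continuous_joint_slice.
have cg : continuous g by exact: torus_integral_slice_continuous.
have cG : continuous G by exact: torus_integral_slice_continuous.
rewrite /Rintegral (@continuous_FTC2 _ g G 0 1)//.
- rewrite /= /G; apply/eqP; rewrite subr_eq0; apply/eqP.
  congr torus_integral; apply/funext => y.
  by rewrite -[in RHS](pV 0) addrC -[delta_mx _ _]scale1r cons_row_shift0 addr0.
- exact: continuous_subspaceT.
- split.
  + by move=> x _; exact: ex_derive.
  + by apply: cvg_at_right_filter; exact: cG.
  + by apply: cvg_at_left_filter; exact: cG.
- by move=> x _; rewrite derive1E derive_val.
Qed.

End TorusCalculus.

(** * Calculus of smooth scalar functions *)

Section SmoothScalar.
Context {R : realType} {V : normedModType R}.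
Implicit Types (f g : V -> R) (D : set V) (v w p : V).

(** The product and chain rules identify derivatives only on an open set, so
smoothness has to be insensitive to the values outside of it. *)
Lemma near_eq_differentiable (W : normedModType R) (f g : V -> W) p :
  (\near p, f p = g p) -> differentiable f p -> differentiable g p.
Proof.
move=> fg df.
have fgp : f p = g p by exact: (nbhs_singleton fg).
have gE : g \o shift p = cst (g p) + 'd f p +o_ 0 id.
  apply/eqaddoP => _/posnumP[e].
  have /eqaddoP/(_ e%:num [gt0 of e%:num]) := diff_locally df.
  apply: filter_app; near=> h; rewrite -fgp.
  suff -> : (f \o shift p - (cst (f p) + 'd f p)) h =
            (g \o shift p - (cst (f p) + 'd f p)) h by [].
  rewrite /= ![(_ - _ : _ -> _) _]/(_ - _) /=; congr (_ - _).
  by near: h; move: fg; rewrite (near_shift 0) subr0.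
have cdf : continuous ('d f p) by exact: diff_continuous.
have dgf := diff_unique cdf gE.
apply/diff_locallyP; rewrite dgf; split => //.
Unshelve. all: by end_near. Qed.

Lemma differentiable_uptoS (W : normedModType R) n D (f : V -> W) :
  differentiable_upto n.+1 D f -> differentiable_upto n D f.
Proof.
elim: n f => [|n IHn] f [df dDf]; first by split.
by split => // v; apply: IHn; exact: dDf.
Qed.

Lemma differentiable_upto_eq (W : normedModType R) n D (f g : V -> W) :
  open D -> (forall x, D x -> f x = g x) ->
  differentiable_upto n D f -> differentiable_upto n D g.
Proof.
move=> oD; elim: n f g => [|n IHn] f g fg [df dDf].
all: have near_fg x : D x -> \near x, f x = g x.
1,3: move=> Dx; apply: filterS (open_nbhs_nbhs (conj oD Dx)) => y; exact: fg.
all: split => [x Dx|]; first exact: near_eq_differentiable (near_fg x Dx) (df x Dx).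
  by [].
move=> v; apply: IHn (dDf v) => x Dx; exact: near_eq_derive (near_fg x Dx).
Qed.

Lemma differentiable_add f g p : differentiable f p -> differentiable g p ->
  differentiable (fun x => f x + g x) p.
Proof. exact: differentiableD. Qed.

Lemma differentiable_sub f g p : differentiable f p -> differentiable g p ->
  differentiable (fun x => f x - g x) p.
Proof. exact: differentiableB. Qed.

Lemma differentiable_mul f g p : differentiable f p -> differentiable g p ->
  differentiable (fun x => f x * g x) p.
Proof. exact: differentiableM. Qed.

Lemma derive_add f g p v : differentiable f p -> differentiable g p ->
  'D_v (fun x => f x + g x) p = 'D_v f p + 'D_v g p.
Proof. by move=> df dg; apply: deriveD; exact: diff_derivable. Qed.

Lemma derive_sub f g p v : differentiable f p -> differentiable g p ->
  'D_v (fun x => f x - g x) p = 'D_v f p - 'D_v g p.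
Proof. by move=> df dg; apply: deriveB; exact: diff_derivable. Qed.

Lemma derive_mul f g p v : differentiable f p -> differentiable g p ->
  'D_v (fun x => f x * g x) p = 'D_v f p * g p + f p * 'D_v g p.
Proof.
move=> df dg.
have E : 'D_v (f * g) p = f p *: 'D_v g p + g p *: 'D_v f p.
  by apply: deriveM; exact: diff_derivable.
transitivity ('D_v (f * g) p); first by [].
by rewrite E addrC; congr (_ + _); exact: mulrC.
Qed.

Lemma derive_mul_eq f g p v (f' g' : R) :
  differentiable f p -> differentiable g p ->
  'D_v f p = f' -> 'D_v g p = g' ->
  'D_v (fun x => f x * g x) p = f' * g p + f p * g'.
Proof. by move=> df dg <- <-; exact: derive_mul. Qed.

Lemma sum_fun_ext n (f : 'I_n -> V -> R) :
  (fun x => \sum_i f i x) = \sum_i f i.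
Proof. by apply/funext => x; rewrite fct_sumE. Qed.

Lemma differentiable_big n (f : 'I_n -> V -> R) p :
  (forall i, differentiable (f i) p) ->
  differentiable (fun x => \sum_i f i x) p.
Proof. by move=> df; rewrite sum_fun_ext; exact: differentiable_sum. Qed.

Lemma derive_big n (f : 'I_n -> V -> R) p v :
  (forall i, differentiable (f i) p) ->
  'D_v (fun x => \sum_i f i x) p = \sum_i 'D_v (f i) p.
Proof.
by move=> df; rewrite sum_fun_ext derive_sum// => i; exact: diff_derivable.
Qed.

Lemma differentiable_upto_cst n D (c : R) :
  differentiable_upto n D (fun _ : V => c).
Proof.
elim: n c => [|n IHn] c; split => //; try by move=> x _; exact: differentiable_cst.
move=> v; have -> : 'D_v (fun=> c) = (fun _ : V => 0 : R).
  by apply/funext => x; exact: derive_cst.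
exact: IHn.
Qed.

Lemma differentiable_uptoD n D f g : open D ->
  differentiable_upto n D f -> differentiable_upto n D g ->
  differentiable_upto n D (fun x => f x + g x).
Proof.
move=> oD; elim: n f g => [|n IHn] f g [df Df] [dg Dg]; split => //.
- by move=> x Dx; apply: differentiableD; [exact: df|exact: dg].
- by move=> x Dx; apply: differentiableD; [exact: df|exact: dg].
move=> v; apply: (differentiable_upto_eq oD _ (IHn _ _ (Df v) (Dg v))).
by move=> x Dx; rewrite derive_add//; [exact: df|exact: dg].
Qed.

Lemma differentiable_uptoM n D f g : open D ->
  differentiable_upto n D f -> differentiable_upto n D g ->
  differentiable_upto n D (fun x => f x * g x).
Proof.
move=> oD; elim: n f g => [|n IHn] f g uf ug.
  have [[df _] [dg _]] := (uf, ug); split => // x Dx.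
  by apply: differentiableM; [exact: df|exact: dg].
have [[df Df] [dg Dg]] := (uf, ug).
split; first by move=> x Dx; apply: differentiableM; [exact: df|exact: dg].
have [uf' ug'] := (differentiable_uptoS uf, differentiable_uptoS ug).
move=> v; apply: (differentiable_upto_eq oD _
  (differentiable_uptoD oD (IHn _ _ (Df v) ug') (IHn _ _ uf' (Dg v)))).
by move=> x Dx; rewrite derive_mul//; [exact: df|exact: dg].
Qed.

Lemma differentiable_upto_sum n m D (f : 'I_m -> V -> R) : open D ->
  (forall i, differentiable_upto n D (f i)) ->
  differentiable_upto n D (fun x => \sum_i f i x).
Proof.
move=> oD; elim: m f => [|m IHm] f uf.
  have -> : (fun x => \sum_i f i x) = (fun=> 0).
    by apply/funext => x; rewrite big_ord0.
  exact: differentiable_upto_cst.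
have -> : (fun x => \sum_i f i x) =
    (fun x => f ord0 x + \sum_i f (lift ord0 i) x).
  by apply/funext => x; rewrite big_ord_recl.
by apply: differentiable_uptoD => //; exact: IHm.
Qed.

Lemma smooth_differentiable (W : normedModType R) D (f : V -> W) p :
  smooth_on D f -> D p -> differentiable f p.
Proof. by move=> /(_ 0%N)[df _]; exact: df. Qed.

Lemma smooth_derive D f v : smooth_on D f -> smooth_on D ('D_v f).
Proof. by move=> sf n; have [_] := sf n.+1; exact. Qed.

Lemma smooth_cst D (c : R) : smooth_on D (fun _ : V => c).
Proof. by move=> n; exact: differentiable_upto_cst. Qed.

Lemma smoothD D f g : open D -> smooth_on D f -> smooth_on D g ->
  smooth_on D (fun x => f x + g x).
Proof. by move=> oD sf sg n; exact: differentiable_uptoD. Qed.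

Lemma smoothM D f g : open D -> smooth_on D f -> smooth_on D g ->
  smooth_on D (fun x => f x * g x).
Proof. by move=> oD sf sg n; exact: differentiable_uptoM. Qed.

Lemma smoothB D f g : open D -> smooth_on D f -> smooth_on D g ->
  smooth_on D (fun x => f x - g x).
Proof.
move=> oD sf sg; have -> : (fun x => f x - g x) = (fun x => f x + (-1) * g x).
  by apply/funext => x; rewrite mulN1r.
by apply: smoothD => //; apply: smoothM => //; exact: smooth_cst.
Qed.

Lemma smooth_sum m D (f : 'I_m -> V -> R) : open D ->
  (forall i, smooth_on D (f i)) -> smooth_on D (fun x => \sum_i f i x).
Proof. by move=> oD sf n; apply: differentiable_upto_sum => // i; exact: sf. Qed.

Lemma differentiable_entry d (f : V -> 'rV[R]_d) i p :
  differentiable f p -> differentiable (fun x => f x 0 i) p.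
Proof.
move=> df.
exact: (differentiable_comp (g := fun y : 'rV[R]_d => y 0 i) df
  (differentiable_coord _ _ _)).
Qed.

Lemma derive_entry d (f : V -> 'rV[R]_d) i p v : differentiable f p ->
  'D_v f p 0 i = 'D_v (fun x => f x 0 i) p.
Proof.
by move=> df; rewrite derive_mx ?mxE//; exact: diff_derivable.
Qed.

Lemma smooth_entry d D (f : V -> 'rV[R]_d) i : open D ->
  smooth_on D f -> smooth_on D (fun x => f x 0 i).
Proof.
move=> oD sf n; have := sf n; elim: n f {sf} => [|n IHn] f [df Df].
  by split => // x Dx; exact/differentiable_entry/df.
split=> [x Dx|v]; first exact/differentiable_entry/df.
apply: (differentiable_upto_eq oD _ (IHn _ (Df v))) => x Dx.
by rewrite derive_entry//; exact: df.
Qed.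

End SmoothScalar.

(** * Symmetry of second derivatives and the chain rule *)

Section Schwarz.
Context {R : realType} {V : normedModType R}.
Implicit Types (f : V -> R) (D : set V) (v w p : V).

Lemma is_derive_line f p v (s : R) : differentiable f (s *: v + p) ->
  is_derive s 1 (fun s : R => f (s *: v + p)) ('D_v f (s *: v + p)).
Proof.
move=> df.
have E : (fun h : R => h^-1 *: (((fun s : R => f (s *: v + p)) \o shift s) (h *: 1)
      - f (s *: v + p))) =
    (fun h : R => h^-1 *: ((f \o shift (s *: v + p)) (h *: v) - f (s *: v + p))).
  by apply/funext => h /=; rewrite [h *: 1]mulr1 scalerDl addrA.
apply: DeriveDef; last by rewrite /derive E.
by rewrite /derivable E; exact: diff_derivable.
Qed.

(** Two applications of the mean value theorem, first along v, then along w. *)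
Lemma double_difference D f p v w (h : R) :
  (forall a b : R, `|a| <= `|h| -> `|b| <= `|h| -> D (b *: w + (a *: v + p))) ->
  (forall x, D x -> differentiable f x) ->
  (forall x, D x -> differentiable ('D_v f) x) ->
  exists a b : R, [/\ `|a| <= `|h|, `|b| <= `|h| &
    f (h *: w + (h *: v + p)) - f (h *: v + p) - (f (h *: w + p) - f p) =
    h * (h * 'D_w ('D_v f) (b *: w + (a *: v + p)))].
Proof.
move=> Dh df dDf.
have h0 : `|0 : R| <= `|h| by rewrite normr0.
pose g (s : R) := f (s *: v + (h *: w + p)) - f (s *: v + p).
pose dg (s : R) := 'D_v f (s *: v + (h *: w + p)) - 'D_v f (s *: v + p).
have [|a ah] := @mean_value_line R g dg 0 h.
  move=> s sh; rewrite addr0; apply: is_deriveB; apply: is_derive_line; apply: df.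
    by rewrite addrCA; exact: Dh.
  by have := Dh s 0 sh h0; rewrite scale0r add0r.
rewrite !addr0 /g /dg !scale0r !add0r => gE.
have [|b bh] := @mean_value_line R (fun s => 'D_v f (s *: w + (a *: v + p)))
  (fun s => 'D_w ('D_v f) (s *: w + (a *: v + p))) 0 h.
  by move=> s sh; rewrite addr0; apply: is_derive_line; apply: dDf; exact: Dh.
rewrite !addr0 scale0r add0r => fE.
exists a, b; split => //; rewrite -fE [h *: w + (a *: v + p)]addrCA -gE.
by rewrite [h *: w + (h *: v + p)]addrCA; ring.
Qed.

(** The second difference quotient is symmetric in v and w, and it is a value of
either mixed derivative at a nearby point; conclude by continuity of both. *)
Lemma derive_commute D f p v w : open D -> smooth_on D f -> D p ->
  'D_w ('D_v f) p = 'D_v ('D_w f) p.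
Proof.
move=> oD sf Dp.
have df x : D x -> differentiable f x by exact: smooth_differentiable.
have dvf x : D x -> differentiable ('D_v f) x.
  exact/smooth_differentiable/smooth_derive.
have dwf x : D x -> differentiable ('D_w f) x.
  exact/smooth_differentiable/smooth_derive.
have cwv : {for p, continuous ('D_w ('D_v f))}.
  apply: differentiable_continuous; apply: smooth_differentiable Dp.
  by do 2 apply: smooth_derive.
have cvw : {for p, continuous ('D_v ('D_w f))}.
  apply: differentiable_continuous; apply: smooth_differentiable Dp.
  by do 2 apply: smooth_derive.
apply/eqP; rewrite -subr_eq0 -normr_le0; apply/ler_addgt0Pl => e e0.
rewrite addr0; have e20 : 0 < e / 2 by rewrite divr_gt0.
pose U : set V := [set x | D x /\
  `|'D_w ('D_v f) p - 'D_w ('D_v f) x| < e / 2 /\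
  `|'D_v ('D_w f) p - 'D_v ('D_w f) x| < e / 2].
have nU : nbhs p U.
  apply: filterI; first exact: open_nbhs_nbhs.
  apply: filterI; first by move/cvgrPdist_lt : cwv; exact.
  by move/cvgrPdist_lt : cvw; exact.
have cl : (fun z : R * R => z.2 *: w + (z.1 *: v + p)) @ (0, 0)
    --> 0 *: w + (0 *: v + p).
  apply: cvgD.
    by apply: cvgZ; [exact: (@continuous_snd R R (0, 0))|exact: cvg_cst].
  apply: cvgD; last exact: cvg_cst.
  by apply: cvgZ; [exact: (@continuous_fst R R (0, 0))|exact: cvg_cst].
have [h h0 hU] : exists2 h : R, h != 0 & forall a b : R,
    `|a| <= `|h| -> `|b| <= `|h| -> U (b *: w + (a *: v + p)).
  move: cl; rewrite !scale0r !add0r => /(_ U nU)[[A B] [/= nA nB] AB].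
  have : nbhs (0 : R) (A `&` B) by exact: filterI.
  move=> /nbhs_ballP[r /= r0 rAB].
  have rb (a : R) : `|a| <= `|r / 2| -> ball (0 : R) r a.
    rewrite [`|r / 2|]gtr0_norm ?divr_gt0// => ar; rewrite /ball/= sub0r normrN.
    by rewrite (le_lt_trans ar)// ltr_pdivrMr// ltr_pMr// ltr1n.
  exists (r / 2); first by rewrite gt_eqF// divr_gt0.
  move=> a b ar br; apply: (AB (a, b)); split.
    exact: (rAB a (rb a ar)).1.
  exact: (rAB b (rb b br)).2.
have [|a [b [ah bh E1]]] := @double_difference D f p v w h _ df dvf.
  by move=> a b ah bh; have [] := hU a b ah bh.
have [|b' [a' [bh' ah' E2]]] := @double_difference D f p w v h _ df dwf.
  by move=> b' a' bh' ah'; have [] := hU a' b' ah' bh'; rewrite addrCA.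
have : h * (h * 'D_w ('D_v f) (b *: w + (a *: v + p))) =
    h * (h * 'D_v ('D_w f) (a' *: v + (b' *: w + p))).
  have swap (x y z t : R) : x - y - (z - t) = x - z - (y - t) by ring.
  have pE : h *: v + (h *: w + p) = h *: w + (h *: v + p) by exact: addrCA.
  by rewrite {}pE in E2; exact: etrans (etrans (esym E1) (swap _ _ _ _)) E2.
move=> /(mulfI h0)/(mulfI h0) E.
have [_ [H1 _]] := hU a b ah bh.
have [_ [_ H2]] := hU a' b' ah' bh'.
have yE : b' *: w + (a' *: v + p) = a' *: v + (b' *: w + p) by exact: addrCA.
rewrite {}yE -{}E in H2; move: H1 H2.
move: ('D_w ('D_v f) _) ('D_w ('D_v f) p) ('D_v ('D_w f) p) => x y z H1 H2.
rewrite -(subrKA x) (splitr e) (le_trans (ler_normD _ _))// lerD//.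
  exact: ltW.
by rewrite distrC ltW.
Qed.

End Schwarz.

Section ProductSpace.
Context {R : realType} {d : nat}.

(** This basis serves both for space-time, with the time derivative along
unit_fst, and for the space of states (rho, q), with F_rho along unit_fst. *)
Definition unit_fst : R * 'rV[R]_d := (1, 0).
Definition unit_snd (k : 'I_d) : R * 'rV[R]_d := (0, delta_mx 0 k).

Lemma pair_decomp (a : R) (b : 'rV[R]_d) :
  (a, b) = a *: unit_fst + \sum_k b 0 k *: unit_snd k.
Proof.
rewrite /unit_fst /unit_snd.
have -> : \sum_k b 0 k *: ((0, delta_mx 0 k) : R * 'rV[R]_d) = (0, b).
  rewrite [in RHS](row_sum_delta b).
  elim: (index_enum _) => [|k s IHs]; first by rewrite !big_nil.
  rewrite !big_cons IHs; congr pair => /=; by rewrite ?scaler0 ?addr0.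
by congr pair; rewrite /= ?addr0 ?[a *: 1]mulr1 ?scaler0 ?add0r.
Qed.

Lemma derive_pair (G : R * 'rV[R]_d -> R) y (w : R * 'rV[R]_d) :
  differentiable G y ->
  'D_w G y = w.1 * 'D_unit_fst G y + \sum_k w.2 0 k * 'D_(unit_snd k) G y.
Proof.
move=> dG; rewrite !deriveE//; case: w => a b /=; rewrite {1}pair_decomp.
rewrite linearD linearZ linear_sum; congr (_ + _).
by apply: eq_bigr => k _; rewrite linearZ deriveE.
Qed.

Context {V : normedModType R}.
Implicit Types (a : V -> R) (b : 'I_d -> V -> R) (p v : V).

(** The map to the state space with components a and b; a linear combination of
constant vectors with scalar coefficients, which reduces its differentiation to
the scalar case. *)
Definition tuple_map a b p : R * 'rV[R]_d := (a p, \row_k b k p).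

Lemma tuple_mapE a b :
  tuple_map a b =
  (fun p => a p *: unit_fst) + \sum_k (fun p => b k p *: unit_snd k).
Proof.
apply/funext => p; rewrite /tuple_map pair_decomp.
rewrite [RHS](_ : _ = a p *: unit_fst + (\sum_k (fun p => b k p *: unit_snd k)) p)//.
by rewrite fct_sumE; congr (_ + _); apply: eq_bigr => k _; rewrite mxE.
Qed.

Lemma differentiable_tuple_map a b p :
  differentiable a p -> (forall k, differentiable (b k) p) ->
  differentiable (tuple_map a b) p.
Proof.
move=> da db; rewrite tuple_mapE; apply: differentiableD.
  exact: differentiableZl.
by apply: differentiable_sum => k; exact: differentiableZl.
Qed.

Lemma derive_tuple_map a b p v :
  differentiable a p -> (forall k, differentiable (b k) p) ->
  'D_v (tuple_map a b) p = ('D_v a p, \row_k 'D_v (b k) p).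
Proof.
move=> da db; have dk k : differentiable (fun p => b k p *: unit_snd k) p.
  exact: differentiableZl.
rewrite tuple_mapE deriveD; last 2 first.
- by apply: diff_derivable; exact: differentiableZl.
- by apply: diff_derivable; exact: differentiable_sum.
rewrite derive_sum; last by move=> k; exact: diff_derivable.
rewrite pair_decomp; congr (_ + _).
  by rewrite deriveE ?diffZl// ?deriveE//; exact: differentiableZl.
by apply: eq_bigr => k _; rewrite deriveE// diffZl// mxE deriveE.
Qed.

Lemma derive_comp (G : R * 'rV[R]_d -> R) a b p v :
  differentiable G (tuple_map a b p) ->
  differentiable a p -> (forall k, differentiable (b k) p) ->
  'D_v (fun p => G (tuple_map a b p)) p =
  'D_('D_v a p, \row_k 'D_v (b k) p) G (tuple_map a b p).
Proof.
move=> dG da db; have dt := differentiable_tuple_map da db.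
rewrite deriveE; last exact: differentiable_comp.
rewrite [X in X v](diff_comp dt dG) /= -(deriveE _ dt) derive_tuple_map//.
by rewrite -deriveE.
Qed.

Lemma derive_chain (G : R * 'rV[R]_d -> R) a b p v :
  differentiable G (tuple_map a b p) ->
  differentiable a p -> (forall k, differentiable (b k) p) ->
  'D_v (fun p => G (tuple_map a b p)) p =
  'D_unit_fst G (tuple_map a b p) * 'D_v a p +
  \sum_k 'D_(unit_snd k) G (tuple_map a b p) * 'D_v (b k) p.
Proof.
move=> dG da db; rewrite derive_comp// derive_pair//= mulrC; congr (_ + _).
by apply: eq_bigr => k _; rewrite mxE mulrC.
Qed.

(** By induction on the order, since the chain rule writes a derivative of the
composition as a sum of products of compositions of the same kind. *)
Lemma smooth_comp (D : set V) (E : set (R * 'rV[R]_d))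
    (G : R * 'rV[R]_d -> R) a b :
  open D -> smooth_on E G -> smooth_on D a -> (forall k, smooth_on D (b k)) ->
  (forall p, D p -> E (tuple_map a b p)) ->
  smooth_on D (fun p => G (tuple_map a b p)).
Proof.
move=> oD sG sa sb DE n; elim: n G sG => [|n IHn] G sG.
all: have dGt x : D x -> differentiable (fun p => G (tuple_map a b p)) x.
1,3: move=> Dx; apply: (differentiable_comp (g := G));
  [apply: differentiable_tuple_map => [|k]; exact: smooth_differentiable Dx
  |exact: smooth_differentiable (DE _ Dx)].
  by [].
split => // v.
apply: (differentiable_upto_eq oD (f := fun p =>
  'D_unit_fst G (tuple_map a b p) * 'D_v a p +
  \sum_k 'D_(unit_snd k) G (tuple_map a b p) * 'D_v (b k) p)).
  move=> x Dx; rewrite derive_chain//.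
  - exact: smooth_differentiable (DE _ Dx).
  - exact: smooth_differentiable Dx.
  - by move=> k; exact: smooth_differentiable Dx.
apply: differentiable_uptoD => //.
  apply: differentiable_uptoM => //; first exact: (IHn _ (smooth_derive _ sG)).
  exact: (smooth_derive v sa n).
apply: differentiable_upto_sum => // k.
apply: differentiable_uptoM => //; first exact: (IHn _ (smooth_derive _ sG)).
exact: (smooth_derive v (sb k) n).
Qed.

End ProductSpace.

(** * Derivatives in coordinates and relative functions *)

Section Coordinates.
Context {R : realType} {d : nat}.
Implicit Types (y w : R * 'rV[R]_d).

Lemma linear_functional (V : normedModType R) (l : V -> R) (y w : V) :
  linear l -> continuous l -> differentiable l y /\ 'D_w l y = l w.
Proof.
move=> ll cl.
pose lM := GRing.isLinear.Build _ _ _ _ _ ll.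
pose L : {linear V -> R} := HB.pack l lM.
have dL : differentiable L y by exact: linear_differentiable.
by split; [exact: dL|rewrite (deriveE _ dL) diff_lin].
Qed.

Lemma derive_fst y w :
  differentiable (fun y : R * 'rV[R]_d => y.1) y /\
  'D_w (fun y : R * 'rV[R]_d => y.1) y = w.1.
Proof. by apply: linear_functional => //; exact: continuous_fst. Qed.

Lemma derive_snd y w k :
  differentiable (fun y : R * 'rV[R]_d => y.2 0 k) y /\
  'D_w (fun y : R * 'rV[R]_d => y.2 0 k) y = w.2 0 k.
Proof.
apply: linear_functional => [c a b|z]; first by rewrite /= !mxE.
exact: (cvg_comp _ _ (@continuous_snd _ _ z) (@coord_continuous _ _ _ 0 k z.2)).
Qed.

Lemma partial_slice (f : R -> 'rV[R]_d -> R) t x k :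
  partial k (f t) x = 'D_(unit_snd k) (fun p => f p.1 p.2) (t, x).
Proof.
rewrite /partial /derive; set q := (fun h : R => _); set q' := (fun h : R => _).
suff -> : q = q' by [].
by apply/funext => h; rewrite /q /q' /= scaler0 add0r.
Qed.

Lemma derive1_slice (W : normedModType R) (f : R -> 'rV[R]_d -> W) t x :
  derive1 (f ^~ x) t = 'D_unit_fst (fun p => f p.1 p.2) (t, x).
Proof.
rewrite derive1E /derive; set q := (fun h : R => _); set q' := (fun h : R => _).
suff -> : q = q' by [].
by apply/funext => h; rewrite /q /q' /= scaler0 add0r.
Qed.

Lemma D_rhoE (g : R -> 'rV[R]_d -> R) r q :
  D_rho g r q = 'D_unit_fst (fun y => g y.1 y.2) (r, q).
Proof. exact: (derive1_slice g). Qed.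

Lemma D_qE (g : R -> 'rV[R]_d -> R) r q :
  D_q g r q = \row_k 'D_(unit_snd k) (fun y => g y.1 y.2) (r, q).
Proof. by apply/rowP => k; rewrite !mxE partial_slice. Qed.

(** The linear part of a relative function is a single directional derivative,
which spares the expansion of mixed second derivatives of F. *)
Lemma relativeE (g : R -> 'rV[R]_d -> R) r q rb qb :
  differentiable (fun y => g y.1 y.2) (rb, qb) ->
  relative g r q rb qb =
  g r q - g rb qb - 'D_(r - rb, q - qb) (fun y => g y.1 y.2) (rb, qb).
Proof.
move=> dg; rewrite /relative derive_pair//= opprD addrA D_rhoE D_qE.
congr (_ - _ - _); first by rewrite mulrC.
by apply: eq_bigr => k _; rewrite !mxE mulrC.
Qed.

End Coordinates.

Section SecondDerivative.
Context {R : realType} {d : nat}.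
Variables (E : set (R * 'rV[R]_d)) (G : R * 'rV[R]_d -> R).
Hypotheses (oE : open E) (sG : smooth_on E G).

Let G0 : R * 'rV[R]_d -> R := 'D_unit_fst G.
Let G1 (k : 'I_d) : R * 'rV[R]_d -> R := 'D_(unit_snd k) G.

Let dG y : E y -> differentiable G y.
Proof. exact: smooth_differentiable. Qed.

Let dG0 y : E y -> differentiable G0 y.
Proof. exact/smooth_differentiable/smooth_derive. Qed.

Let dG1 k y : E y -> differentiable (G1 k) y.
Proof. exact/smooth_differentiable/smooth_derive. Qed.

Lemma second_derivative_split y v (c0 : R) (c : 'I_d -> R) : E y ->
  'D_v ('D_(c0, \row_k c k) G) y =
  c0 * 'D_v G0 y + \sum_k c k * 'D_v (G1 k) y.
Proof.
move=> Ey.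
transitivity ('D_v (fun x => c0 * G0 x + \sum_k c k * G1 k x) y).
  apply: near_eq_derive; near=> x.
  have Ex : E x by near: x; exact: open_nbhs_nbhs.
  rewrite (derive_pair _ (dG Ex)) /=; congr (_ + _).
  by apply: eq_bigr => k _; congr (_ * _); exact: mxE.
have dc (x : R) : differentiable (fun _ : R * 'rV[R]_d => x) y.
  exact: differentiable_cst.
have d0 : differentiable (fun x => c0 * G0 x) y.
  exact: (differentiable_mul (dc c0) (dG0 Ey)).
have d1 k : differentiable (fun x => c k * G1 k x) y.
  exact: (differentiable_mul (dc (c k)) (dG1 k Ey)).
apply: etrans (derive_add v d0 (differentiable_big d1)) _.
congr (_ + _).
  apply: etrans (derive_mul v (dc c0) (dG0 Ey)) _.
  by rewrite derive_cst mul0r add0r.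
apply: etrans (derive_big v d1) _; apply: eq_bigr => k _.
apply: etrans (derive_mul v (dc (c k)) (dG1 k Ey)) _.
by rewrite derive_cst mul0r add0r.
Unshelve. all: by end_near. Qed.

(** The Hessian of G as a symmetric bilinear form, evaluated on (w0, w) and
(z0, z). *)
Lemma second_derivative_sym y (w0 z0 : R) (w z : 'I_d -> R) : E y ->
  w0 * 'D_(z0, \row_k z k) G0 y + \sum_k w k * 'D_(z0, \row_k z k) (G1 k) y =
  z0 * 'D_(w0, \row_k w k) G0 y + \sum_k z k * 'D_(w0, \row_k w k) (G1 k) y.
Proof.
move=> Ey.
apply: etrans (esym (second_derivative_split _ _ _ Ey)) _.
apply: etrans (derive_commute _ _ oE sG Ey) _.
exact: second_derivative_split.
Qed.

End SecondDerivative.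

Section RelativeFunctions.
Context {R : realType} {d : nat}.
Variables (E : set (R * 'rV[R]_d)) (F : R -> 'rV[R]_d -> R).

Let G (y : R * 'rV[R]_d) := F y.1 y.2.
Hypothesis sG : smooth_on E G.

Let G0 : R * 'rV[R]_d -> R := 'D_unit_fst G.
Let G1 (k : 'I_d) : R * 'rV[R]_d -> R := 'D_(unit_snd k) G.

Let dG y : E y -> differentiable G y.
Proof. exact: smooth_differentiable. Qed.

Let dG0 y : E y -> differentiable G0 y.
Proof. exact/smooth_differentiable/smooth_derive. Qed.

Let dG1 k y : E y -> differentiable (G1 k) y.
Proof. exact/smooth_differentiable/smooth_derive. Qed.

Section AtStates.
Variables (r rb : R) (q qb : 'rV[R]_d).
Hypothesis Erb : E (rb, qb).

Let w : R * 'rV[R]_d := (r - rb, q - qb).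
Let a : R := G0 (r, q) - G0 (rb, qb).
Let b k : R := G1 k (r, q) - G1 k (rb, qb).
Let X : R := 'D_w G0 (rb, qb).
Let Y k : R := 'D_w (G1 k) (rb, qb).

Lemma relative_expand :
  relative F r q rb qb = G (r, q) - G (rb, qb) -
    ((r - rb) * G0 (rb, qb) + \sum_k (q 0 k - qb 0 k) * G1 k (rb, qb)).
Proof.
rewrite relativeE; last exact: dG.
rewrite derive_pair/=; last exact: dG.
by congr (_ - (_ + _)); apply: eq_bigr => k _; rewrite !mxE.
Qed.

(** The terms of the derivative of s in which F is differentiated once cancel, so
that the linear part of s only sees X and Y. *)
Lemma relative_s_expand :
  relative (s_fun F) r q rb qb =
  r * a + \sum_k q 0 k * b k - (rb * X + \sum_k qb 0 k * Y k)
  - relative F r q rb qb.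
Proof.
pose S (y : R * 'rV[R]_d) : R := y.1 * G0 y + \sum_k y.2 0 k * G1 k y - G y.
have sE : (fun y => s_fun F y.1 y.2) = S.
  apply/funext => -[r' q']; rewrite /s_fun /S /= D_rhoE D_qE /dot.
  by congr (_ + _ - _); apply: eq_bigr => k _; rewrite mxE.
have d1 y : E y -> differentiable (fun y : R * 'rV[R]_d => y.1 * G0 y) y.
  move=> Ey; apply: differentiableM; last exact: dG0.
  exact: (derive_fst y y).1.
have d2 y k : E y -> differentiable (fun y : R * 'rV[R]_d => y.2 0 k * G1 k y) y.
  move=> Ey; apply: differentiableM; last exact: dG1.
  exact: (derive_snd y y k).1.
have d12 y : E y ->
    differentiable (fun y : R * 'rV[R]_d => y.1 * G0 y + \sum_k y.2 0 k * G1 k y) y.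
  move=> Ey; apply: differentiableD; first exact: d1.
  by apply: differentiable_big => k; exact: d2.
have dS y : E y -> differentiable S y.
  by move=> Ey; apply: differentiableB; [exact: d12|exact: dG].
have DS : 'D_w S (rb, qb) = rb * X + \sum_k qb 0 k * Y k.
  rewrite derive_sub; [|exact: d12|exact: dG].
  rewrite derive_add; [|exact: d1|by apply: differentiable_big => k; exact: d2].
  rewrite derive_mul; [|exact: (derive_fst _ w).1|exact: dG0].
  rewrite derive_big; last by move=> k; exact: d2.
  rewrite (derive_fst _ w).2 (derive_pair w (dG Erb)) /=.
  under eq_bigr => k _.
    rewrite derive_mul; [|exact: (derive_snd _ w k).1|exact: dG1].
    rewrite (derive_snd _ w k).2; over.
  have cancel (x1 x2 x3 x4 : R) : x1 + x2 + (x3 + x4) - (x1 + x3) = x2 + x4.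
    by ring.
  by rewrite big_split/=; exact: cancel.
rewrite relativeE sE; last exact: dS.
rewrite -/w DS relative_expand /S/= /a /b.
have E1 : \sum_k q 0 k * (G1 k (r, q) - G1 k (rb, qb)) =
    \sum_k q 0 k * G1 k (r, q) - \sum_k q 0 k * G1 k (rb, qb).
  by rewrite -sumrB; apply: eq_bigr => k _; rewrite mulrBr.
have E2 : \sum_k (q 0 k - qb 0 k) * G1 k (rb, qb) =
    \sum_k q 0 k * G1 k (rb, qb) - \sum_k qb 0 k * G1 k (rb, qb).
  by rewrite -sumrB; apply: eq_bigr => k _; rewrite mulrBl.
have sFE r' q' : s_fun F r' q' = S (r', q') by rewrite -sE.
by rewrite !sFE /S/= E1 E2; ring.
Qed.

Lemma relative_r_expand j :
  relative_vec (r_fun F) r q rb qb 0 j = r * b j - rb * Y j.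
Proof.
have rE : (fun y => r_fun F y.1 y.2 0 j) = (fun y => y.1 * G1 j y).
  by apply/funext => -[r' q']; rewrite /r_fun D_qE !mxE.
rewrite mxE relativeE rE; last first.
  by apply: differentiableM; [exact: (derive_fst _ w).1|exact: dG1].
rewrite derive_mul; [|exact: (derive_fst _ w).1|exact: dG1].
have rfE r' q' : r_fun F r' q' 0 j = r' * G1 j (r', q').
  by have := congr1 (fun f => f (r', q')) rE.
rewrite (derive_fst _ w).2 !rfE -/w -/(Y j) /b/=; ring.
Qed.

Lemma relative_H_expand i j :
  relative_mx (H_fun F) r q rb qb i j = q 0 i * b j - qb 0 i * Y j.
Proof.
have hE : (fun y => H_fun F y.1 y.2 i j) = (fun y => y.2 0 i * G1 j y).
  by apply/funext => -[r' q']; rewrite /H_fun D_qE !mxE.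
rewrite mxE relativeE hE; last first.
  by apply: differentiableM; [exact: (derive_snd _ w i).1|exact: dG1].
rewrite derive_mul; [|exact: (derive_snd _ w i).1|exact: dG1].
have hfE r' q' : H_fun F r' q' i j = q' 0 i * G1 j (r', q').
  by have := congr1 (fun f => f (r', q')) hE.
rewrite (derive_snd _ w i).2 !hfE -/w -/(Y j) /b/= !mxE; ring.
Qed.

End AtStates.

End RelativeFunctions.

Section SliceDerivatives.
Context {R : realType} {d : nat}.

Local Notation P := (R * 'rV[R]_d)%type.
Local Notation dt f := ('D_unit_fst f).
Local Notation dx k f := ('D_(unit_snd k) f).

Lemma shift_unit_fst (h t : R) (x : 'rV[R]_d) :
  h *: unit_fst + (t, x) = (h + t, x).
Proof. by congr pair; rewrite /= ?[h *: 1]mulr1 ?scaler0 ?add0r. Qed.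

Lemma shift_unit_snd k (h t : R) (x : 'rV[R]_d) :
  h *: unit_snd k + (t, x) = (t, h *: delta_mx 0 k + x).
Proof. by congr pair; rewrite /= ?scaler0 ?add0r. Qed.

Definition x_periodic (I : set R) (W : Type) (f : P -> W) : Prop :=
  forall t, I t -> Defs.periodic (fun x => f (t, x)).

(** The difference quotients of f at two points that differ by a period are equal. *)
Lemma x_periodic_derive (I : set R) k (f : P -> R) : x_periodic I f -> x_periodic I (dx k f).
Proof.
move=> pf t It i x; rewrite /derive.
set g := (fun h : R => _); set g' := (fun h : R => _).
suff -> : g = g' by [].
apply/funext => h; rewrite /g /g' /= !shift_unit_snd addrA.
by rewrite (pf t It i x) (pf t It i (h *: delta_mx 0 k + x)).
Qed.

Lemma is_derive_slice (f : P -> R) t x : differentiable f (t, x) ->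
  is_derive t 1 (fun s => f (s, x)) (dt f (t, x)).
Proof.
move=> df; have E : (fun h : R => h^-1 *: (((fun s => f (s, x)) \o shift t) (h *: 1)
      - f (t, x))) =
    (fun h : R => h^-1 *: ((f \o shift (t, x)) (h *: unit_fst) - f (t, x))).
  by apply/funext => h /=; rewrite shift_unit_fst [h *: 1]mulr1.
apply: DeriveDef; last by rewrite /derive E.
by rewrite /derivable E; exact: diff_derivable.
Qed.

Lemma derivable_slice (f : P -> R) t x k : differentiable f (t, x) ->
  derivable (fun y => f (t, y)) x (delta_mx 0 k).
Proof.
move=> df; have E : (fun h : R => h^-1 *:
      (((fun y => f (t, y)) \o shift x) (h *: delta_mx 0 k) - f (t, x))) =
    (fun h : R => h^-1 *: ((f \o shift (t, x)) (h *: unit_snd k) - f (t, x))).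
  by apply/funext => h /=; rewrite shift_unit_snd.
by rewrite /derivable E; exact: diff_derivable.
Qed.

End SliceDerivatives.

(** * Algebraic identities for finite sums *)

Section FiniteSums.
Context {R : realType} {d : nat}.
Implicit Types (x y z : 'I_d -> R) (f g h : 'I_d -> 'I_d -> R).

(** P and Q stand for the gradients of G at the two states, v and z for the
derivatives of their components, s and t for the gap between the states, d0 and
e for the derivatives of Q; the hypothesis is the symmetry of the Hessian. *)
Lemma relative_energy_algebra (P0 Q0 X s d0 v0 z0 : R) P Q Y t e v z :
  s * d0 + \sum_k t k * e k = z0 * X + \sum_k z k * Y k ->
  P0 * v0 + \sum_k P k * v k - (Q0 * z0 + \sum_k Q k * z k)
  - ((v0 - z0) * Q0 + s * d0 + \sum_k ((v k - z k) * Q k + t k * e k)) =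
  (P0 - Q0) * v0 + \sum_(k < d) (P k - Q k) * v k
  - (X * z0 + \sum_k Y k * z k).
Proof.
move=> sym.
have E1 : \sum_k ((v k - z k) * Q k + t k * e k) =
    \sum_k Q k * v k - \sum_k Q k * z k + \sum_k t k * e k.
  by rewrite -sumrB -big_split; apply: eq_bigr => k _ /=; ring.
have E2 : \sum_(k < d) (P k - Q k) * v k =
    \sum_k P k * v k - \sum_k Q k * v k.
  by rewrite -sumrB; apply: eq_bigr => k _ /=; ring.
have E3 : \sum_k Y k * z k = \sum_k z k * Y k.
  by apply: eq_bigr => k _; rewrite mulrC.
rewrite E1 E2 E3; move: sym.
move: (\sum_k t k * e k) (\sum_k z k * Y k) => T Z sym.
have -> : Z = s * d0 + T - z0 * X by rewrite sym; ring.
by ring.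
Qed.

(** Here f, g and h stand for the first derivatives of phi, the second derivatives
of phi and the Hessian of the density. *)
Lemma transport_algebra (a r : R) b q phi f g h :
  (forall j k, h j k = h k j) ->
  a * \sum_k (q k * phi k + r * f k k)
  + \sum_j b j * \sum_k (h j k * phi k + q k * f j k
                         + (q j * f k k + r * g j k)) =
  (\sum_k f k k) * (r * a + \sum_j q j * b j)
  + \sum_j (\sum_k g j k) * (r * b j)
  + \sum_i \sum_j f j i * (q i * b j)
  + \sum_k phi k * (a * q k + \sum_j b j * h k j).
Proof.
move=> hC.
have E1 : a * \sum_k (q k * phi k + r * f k k) =
    a * \sum_k q k * phi k + a * r * \sum_k f k k.
  by rewrite big_split/= -mulr_sumr; ring.
have E2 : \sum_j b j * \sum_k (h j k * phi k + q k * f j k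
                         + (q j * f k k + r * g j k)) =
    \sum_j \sum_k b j * h j k * phi k + \sum_j \sum_k f j k * (q k * b j)
    + ((\sum_k f k k) * (\sum_j q j * b j)
       + \sum_j (\sum_k g j k) * (r * b j)).
  rewrite mulr_sumr -!big_split; apply: eq_bigr => j _ /=.
  rewrite !big_split/= -!mulr_sumr.
  have -> : \sum_k b j * h j k * phi k = b j * \sum_k h j k * phi k.
    by rewrite mulr_sumr; apply: eq_bigr => k _; ring.
  have -> : \sum_k f j k * (q k * b j) = b j * \sum_k q k * f j k.
    by rewrite mulr_sumr; apply: eq_bigr => k _; ring.
  by ring.
have E3 : \sum_k phi k * (a * q k + \sum_j b j * h k j) =
    a * \sum_k q k * phi k + \sum_j \sum_k b j * h j k * phi k.
  rewrite exchange_big/= mulr_sumr -big_split; apply: eq_bigr => k _ /=.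
  have -> : \sum_j b j * h j k * phi k = phi k * \sum_j b j * h k j.
    by rewrite mulr_sumr; apply: eq_bigr => j _; rewrite hC; ring.
  by ring.
rewrite E1 E2 E3 [X in _ = _ + _ + X + _]exchange_big/=; ring.
Qed.

(** The convective terms combine through
u . grad u - phi . grad phi = u . grad w + w . grad phi. *)
Lemma kinetic_algebra (rho zeta : R) u phi M N ut phit
    (Du Dphi : 'I_d -> 'I_d -> R) :
  (forall i, ut i = - (\sum_j u j * Du j i) - M i - zeta * u i) ->
  (forall i, phit i = - (\sum_j phi j * Dphi j i) - N i - zeta * phi i) ->
  let w i := u i - phi i in
  rho * \sum_i w i * (ut i - phit i) + zeta * (rho * \sum_i w i * w i)
  + rho * \sum_i \sum_j Dphi j i * (w i * w j) =
  - \sum_k (rho * u k) * \sum_i w i * (Du k i - Dphi k i)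
  - \sum_i rho * w i * (M i - N i).
Proof.
move=> utE phitE w.
have E1 : \sum_k (rho * u k) * \sum_i w i * (Du k i - Dphi k i) =
    rho * \sum_i w i * \sum_k u k * (Du k i - Dphi k i).
  under eq_bigr do rewrite mulr_sumr.
  rewrite exchange_big/= mulr_sumr; apply: eq_bigr => i _.
  by rewrite !mulr_sumr; apply: eq_bigr => k _; ring.
have E2 : \sum_i rho * w i * (M i - N i) = rho * \sum_i w i * (M i - N i).
  by rewrite mulr_sumr; apply: eq_bigr => i _; ring.
rewrite E1 E2 -mulrN -mulrBr [zeta * _]mulrCA -!mulrDr; congr (_ * _).
rewrite mulr_sumr -sumrN -sumrB -!big_split; apply: eq_bigr => i _ /=.
have -> : \sum_j Dphi j i * (w i * w j) = w i * \sum_j w j * Dphi j i.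
  by rewrite mulr_sumr; apply: eq_bigr => j _; ring.
have -> : \sum_k u k * (Du k i - Dphi k i) =
    \sum_k u k * Du k i - \sum_k phi k * Dphi k i - \sum_k w k * Dphi k i.
  by rewrite -!sumrB; apply: eq_bigr => k _; rewrite /w; ring.
by rewrite utE phitE /w; ring.
Qed.

(** The first two hypotheses are the transport identity for (a, b, rho) and for
(X, Y, rhob); the next four are the continuity equations and their gradients. *)
Lemma balance_algebra (a r rb X m mb c dv Rel rt rbt : R)
    (b Y q qb phi g dm dmb dc rtx rbtx A1 A2 : 'I_d -> R)
    (f : 'I_d -> 'I_d -> R) :
  a * m + \sum_j b j * dm j =
    dv * (r * a + \sum_j q j * b j) + \sum_j g j * (r * b j)
    + \sum_i \sum_j f j i * (q i * b j) + \sum_k phi k * A1 k ->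
  X * mb + \sum_j Y j * dmb j =
    dv * (rb * X + \sum_j qb j * Y j) + \sum_j g j * (rb * Y j)
    + \sum_i \sum_j f j i * (qb i * Y j) + \sum_k phi k * A2 k ->
  rt = - (m + c) -> (forall j, rtx j = - (dm j + dc j)) ->
  rbt = - mb -> (forall j, rbtx j = - dmb j) ->
  a * rt + \sum_j b j * rtx j - (X * rbt + \sum_j Y j * rbtx j)
  + (dv * (r * a + \sum_j q j * b j - (rb * X + \sum_j qb j * Y j) - Rel)
     + \sum_j g j * (r * b j - rb * Y j)
     + \sum_i \sum_j f j i * (q i * b j - qb i * Y j)) =
  - (a * c + \sum_j b j * dc j)
  - (\sum_k (A1 k - A2 k) * phi k + Rel * dv).
Proof.
move=> T1 T2 -> rtxE -> rbtxE.
have -> : \sum_j b j * rtx j = - \sum_j b j * dm j - \sum_j b j * dc j.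
  by rewrite -sumrN -sumrB; apply: eq_bigr => j _; rewrite rtxE; ring.
have -> : \sum_j Y j * rbtx j = - \sum_j Y j * dmb j.
  by rewrite -sumrN; apply: eq_bigr => j _; rewrite rbtxE; ring.
have -> : \sum_j g j * (r * b j - rb * Y j) =
    \sum_j g j * (r * b j) - \sum_j g j * (rb * Y j).
  by rewrite -sumrB; apply: eq_bigr => j _; ring.
have -> : \sum_i \sum_j f j i * (q i * b j - qb i * Y j) =
    \sum_i \sum_j f j i * (q i * b j) - \sum_i \sum_j f j i * (qb i * Y j).
  rewrite -sumrB; apply: eq_bigr => i _.
  by rewrite -sumrB; apply: eq_bigr => j _; ring.
have -> : \sum_k (A1 k - A2 k) * phi k =
    \sum_k phi k * A1 k - \sum_k phi k * A2 k.
  by rewrite -sumrB; apply: eq_bigr => k _; ring.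
have {T1}-> : \sum_j b j * dm j = dv * (r * a + \sum_j q j * b j)
    + \sum_j g j * (r * b j) + \sum_i \sum_j f j i * (q i * b j)
    + \sum_k phi k * A1 k - a * m.
  by rewrite -T1; ring.
have {T2}-> : \sum_j Y j * dmb j = dv * (rb * X + \sum_j qb j * Y j)
    + \sum_j g j * (rb * Y j) + \sum_i \sum_j f j i * (qb i * Y j)
    + \sum_k phi k * A2 k - X * mb.
  by rewrite -T2; ring.
by ring.
Qed.

End FiniteSums.

(** * The pointwise balance law *)

(* Comparing two derivatives of distinct functions must not unfold their
   definition as limits: unification would otherwise explore both limits. *)
#[local] Opaque derive.

Section SpaceTime.
Context {R : realType} {d : nat}.

Local Notation P := (R * 'rV[R]_d)%type.
Local Notation dt f := ('D_unit_fst f).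
Local Notation dx k f := ('D_(unit_snd k) f).

(** The state (rho, grad rho) at which F is evaluated. *)
Definition jet (r : P -> R) : P -> P := tuple_map r (fun k => dx k r).

Definition div_x (v : 'I_d -> P -> R) (p : P) : R := \sum_k dx k (v k) p.

Variable D : set P.
Hypothesis oD : open D.

Lemma smooth_div_x (v : 'I_d -> P -> R) : (forall k, smooth_on D (v k)) ->
  smooth_on D (div_x v).
Proof. by move=> sv; apply: smooth_sum => // k; exact: smooth_derive. Qed.

Lemma derive_eq_on (f g : P -> R) p v : (forall x, D x -> f x = g x) -> D p ->
  'D_v f p = 'D_v g p.
Proof.
move=> fg Dp; apply: near_eq_derive.
by apply: filterS (open_nbhs_nbhs (conj oD Dp)) => x; exact: fg.
Qed.

Lemma div_xM (f : P -> R) (v : 'I_d -> P -> R) p :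
  differentiable f p -> (forall k, differentiable (v k) p) ->
  div_x (fun k x => f x * v k x) p =
  \sum_k dx k f p * v k p + f p * div_x v p.
Proof.
move=> df dv; rewrite /div_x mulr_sumr -big_split; apply: eq_bigr => k _ /=.
by rewrite derive_mul.
Qed.

Lemma div_xD (v w : 'I_d -> P -> R) p : (forall k, differentiable (v k) p) ->
  (forall k, differentiable (w k) p) ->
  div_x (fun k x => v k x + w k x) p = div_x v p + div_x w p.
Proof.
move=> dv dw; rewrite /div_x -big_split; apply: eq_bigr => k _ /=.
by rewrite derive_add.
Qed.

(** Since m = r div phi + phi . grad r, its gradient contains div phi, its gradient
and the gradient of phi, plus the Hessian of r applied to phi, which is a
derivative of grad r along phi because the Hessian is symmetric. *)
Lemma transport_identity (r : P -> R) (phi : 'I_d -> P -> R) (a : R)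
    (b : 'I_d -> R) p :
  smooth_on D r -> (forall k, smooth_on D (phi k)) -> D p ->
  let m := div_x (fun k x => r x * phi k x) in
  a * m p + \sum_j b j * dx j m p =
  div_x phi p * (r p * a + \sum_j dx j r p * b j)
  + \sum_j dx j (div_x phi) p * (r p * b j)
  + \sum_i \sum_j dx j (phi i) p * (dx i r p * b j)
  + \sum_k phi k p * (a * dx k r p + \sum_j b j * dx k (dx j r) p).
Proof.
move=> sr sphi Dp m.
have dr x : D x -> differentiable r x by exact: smooth_differentiable.
have dphi k x : D x -> differentiable (phi k) x by exact: smooth_differentiable.
have ddr k x : D x -> differentiable (dx k r) x.
  exact/smooth_differentiable/smooth_derive.
have ddphi k j x : D x -> differentiable (dx k (phi j)) x.
  exact/smooth_differentiable/smooth_derive.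
have mE x : D x -> m x = \sum_k (dx k r x * phi k x + r x * dx k (phi k) x).
  by move=> Dx; apply: eq_bigr => k _; rewrite derive_mul; auto.
have dmE j : dx j m p = \sum_k
    (dx j (dx k r) p * phi k p + dx k r p * dx j (phi k) p
     + (dx j r p * dx k (phi k) p + r p * dx j (dx k (phi k)) p)).
  rewrite (derive_eq_on _ mE Dp) derive_big; last first.
    by move=> k; apply: differentiable_add; apply: differentiable_mul; auto.
  apply: eq_bigr => k _; rewrite derive_add.
  - by rewrite !derive_mul; auto.
  - by apply: differentiable_mul; auto.
  - by apply: differentiable_mul; auto.
have ddivE j : dx j (div_x phi) p = \sum_k dx j (dx k (phi k)) p.
  by rewrite derive_big; auto.
under eq_bigr do rewrite dmE.
rewrite mE//.
under [X in _ = _ + X + _ + _]eq_bigr do rewrite ddivE.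
apply: (transport_algebra a (r p) b (fun k => dx k r p) (fun k => phi k p)
  (fun j k => dx j (phi k) p) (fun j k => dx j (dx k (phi k)) p)
  (h := fun j k => dx j (dx k r) p)) => j k.
exact: derive_commute oD sr Dp.
Qed.

Variables (E : set P) (G : P -> R).
Hypotheses (oE : open E) (sG : smooth_on E G).

Let G0 : P -> R := dt G.
Let G1 k : P -> R := dx k G.

Let sG0 : smooth_on E G0. Proof. exact: smooth_derive. Qed.
Let sG1 k : smooth_on E (G1 k). Proof. exact: smooth_derive. Qed.

Lemma smooth_jet (r : P -> R) (H : P -> R) : smooth_on E H -> smooth_on D r ->
  (forall p, D p -> E (jet r p)) -> smooth_on D (fun p => H (jet r p)).
Proof.
by move=> sH sr Er; apply: smooth_comp Er => // k; exact: smooth_derive.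
Qed.

(** The chemical potential, as a function on space-time. *)
Definition potential (r : P -> R) (p : P) : R :=
  dt G (jet r p) - div_x (fun k x => dx k G (jet r x)) p.

Lemma smooth_potential r : smooth_on D r -> (forall p, D p -> E (jet r p)) ->
  smooth_on D (potential r).
Proof.
move=> sr Er; apply: smoothB => //; first exact: (smooth_jet sG0 sr Er).
by apply: smooth_div_x => k; exact: (smooth_jet (sG1 k) sr Er).
Qed.

Section TwoDensities.
Variables r rb : P -> R.
Hypotheses (sr : smooth_on D r) (srb : smooth_on D rb).
Hypotheses (Er : forall p, D p -> E (jet r p)).
Hypotheses (Erb : forall p, D p -> E (jet rb p)).

Definition relative_density (p : P) : R :=
  G (jet r p) - G (jet rb p) - ((r p - rb p) * dt G (jet rb p)
    + \sum_k (dx k r p - dx k rb p) * dx k G (jet rb p)).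

Let a p := G0 (jet r p) - G0 (jet rb p).
Let b k p := G1 k (jet r p) - G1 k (jet rb p).
Let W p : P := (r p - rb p, \row_k (dx k r p - dx k rb p)).
Let X p := 'D_(W p) G0 (jet rb p).
Let Y k p := 'D_(W p) (G1 k) (jet rb p).

Let dr x : D x -> differentiable r x. Proof. exact: smooth_differentiable. Qed.
Let drb x : D x -> differentiable rb x.
Proof. exact: smooth_differentiable. Qed.
Let ddr k x : D x -> differentiable (dx k r) x.
Proof. exact/smooth_differentiable/smooth_derive. Qed.
Let ddrb k x : D x -> differentiable (dx k rb) x.
Proof. exact/smooth_differentiable/smooth_derive. Qed.
Let sG0rb : smooth_on D (fun x => G0 (jet rb x)).
Proof. exact: (smooth_jet sG0 srb Erb). Qed.
Let sG1r k : smooth_on D (fun x => G1 k (jet r x)).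
Proof. exact: (smooth_jet (sG1 k) sr Er). Qed.
Let sG1rb k : smooth_on D (fun x => G1 k (jet rb x)).
Proof. exact: (smooth_jet (sG1 k) srb Erb). Qed.
Let sb k : smooth_on D (b k).
Proof. exact: (smoothB oD (sG1r k) (sG1rb k)). Qed.

Lemma smooth_relative_density : smooth_on D relative_density.
Proof.
have s1 := smooth_jet sG sr Er.
have s2 := smooth_jet sG srb Erb.
apply: (smoothB oD (smoothB oD s1 s2)); apply: (smoothD oD).
  exact: (smoothM oD (smoothB oD sr srb) sG0rb).
apply: smooth_sum => // k; apply: (smoothM oD _ (sG1rb k)).
by apply: (smoothB oD); exact: smooth_derive.
Qed.

(** The derivatives of the first-order part of the expansion at rb produce the
Hessian of G evaluated on the gap and on the derivative of the jet of rb; its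
symmetry turns them into the factors X and Y. *)
Lemma derive_relative_density p v : D p ->
  'D_v relative_density p =
  a p * 'D_v r p + \sum_k b k p * 'D_v (dx k r) p
  - (X p * 'D_v rb p + \sum_k Y k p * 'D_v (dx k rb) p).
Proof.
move=> Dp.
have dGr : differentiable (fun x => G (jet r x)) p.
  exact: smooth_differentiable (smooth_jet sG sr Er) Dp.
have dGrb : differentiable (fun x => G (jet rb x)) p.
  exact: smooth_differentiable (smooth_jet sG srb Erb) Dp.
have d0 := smooth_differentiable sG0rb Dp.
have d1 k := smooth_differentiable (sG1rb k) Dp.
have dgap k : differentiable (fun x => dx k r x - dx k rb x) p.
  by apply: differentiable_sub; auto.
have dgap0 : differentiable (fun x => r x - rb x) p.
  by apply: differentiable_sub; auto.
have dprod k : differentiable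
    (fun x => (dx k r x - dx k rb x) * G1 k (jet rb x)) p.
  exact: (differentiable_mul (dgap k) (d1 k)).
have dprod0 : differentiable (fun x => (r x - rb x) * G0 (jet rb x)) p.
  exact: (differentiable_mul dgap0 d0).
pose Z : P := ('D_v rb p, \row_k 'D_v (dx k rb) p).
have DG0 : 'D_v (fun x => G0 (jet rb x)) p = 'D_Z G0 (jet rb p).
  apply: derive_comp; [|exact: drb|by move=> k; exact: ddrb].
  exact: smooth_differentiable sG0 (Erb Dp).
have DG1 k : 'D_v (fun x => G1 k (jet rb x)) p = 'D_Z (G1 k) (jet rb p).
  apply: derive_comp; [|exact: drb|by move=> j; exact: ddrb].
  exact: smooth_differentiable (sG1 k) (Erb Dp).
have Dlin0 : 'D_v (fun x => (r x - rb x) * G0 (jet rb x)) p =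
    ('D_v r p - 'D_v rb p) * G0 (jet rb p) + (r p - rb p) * 'D_Z G0 (jet rb p).
  exact: (derive_mul_eq dgap0 d0 (derive_sub v (dr Dp) (drb Dp)) DG0).
have Dlin k : 'D_v (fun x => (dx k r x - dx k rb x) * G1 k (jet rb x)) p =
    ('D_v (dx k r) p - 'D_v (dx k rb) p) * G1 k (jet rb p)
    + (dx k r p - dx k rb p) * 'D_Z (G1 k) (jet rb p).
  exact: (derive_mul_eq (dgap k) (d1 k)
    (derive_sub v (ddr k Dp) (ddrb k Dp)) (DG1 k)).
have chain (s : P -> R) : smooth_on D s -> (forall x, D x -> E (jet s x)) ->
    'D_v (fun x => G (jet s x)) p =
    G0 (jet s p) * 'D_v s p + \sum_k G1 k (jet s p) * 'D_v (dx k s) p.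
  move=> ss Es; apply: derive_chain.
  - exact: smooth_differentiable sG (Es _ Dp).
  - exact: smooth_differentiable ss Dp.
  - by move=> k; exact: smooth_differentiable (smooth_derive _ ss) Dp.
have sym : (r p - rb p) * 'D_Z G0 (jet rb p)
    + \sum_k (dx k r p - dx k rb p) * 'D_Z (G1 k) (jet rb p) =
    'D_v rb p * X p + \sum_k 'D_v (dx k rb) p * Y k p.
  exact: (second_derivative_sym oE sG _ _ _ _ (Erb Dp)).
have dsum := differentiable_big dprod.
have Dsum := etrans (derive_big v dprod) (eq_bigr _ (fun k _ => Dlin k)).
have E1 := derive_sub v dGr dGrb.
have E2 := derive_add v dprod0 dsum.
have E3 := derive_sub v (differentiable_sub dGr dGrb)
  (differentiable_add dprod0 dsum).
apply: (etrans E3).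
apply: etrans (relative_energy_algebra _ _ _ _ _ _ sym).
apply: (congr2 (fun x y => x - y)).
  by apply: (etrans E1); rewrite (chain r sr Er) (chain rb srb Erb).
by apply: (etrans E2); apply: (congr2 (fun x y => x + y)).
Qed.

Variables (u ub : 'I_d -> P -> R).
Hypotheses (su : forall k, smooth_on D (u k)).
Hypotheses (sub : forall k, smooth_on D (ub k)).
Hypothesis continuity : forall p, D p ->
  dt r p = - div_x (fun k x => r x * u k x) p.
Hypothesis continuityb : forall p, D p ->
  dt rb p = - div_x (fun k x => rb x * ub k x) p.

Let w k (x : P) := u k x - ub k x.
Let c : P -> R := div_x (fun k x => r x * w k x).
Let m : P -> R := div_x (fun k x => r x * ub k x).
Let mb : P -> R := div_x (fun k x => rb x * ub k x).

Let sw k : smooth_on D (w k).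
Proof. exact: (smoothB oD (su k) (sub k)). Qed.
Let srw k : smooth_on D (fun x => r x * w k x).
Proof. exact: (smoothM oD sr (sw k)). Qed.
Let srub k : smooth_on D (fun x => r x * ub k x).
Proof. exact: (smoothM oD sr (sub k)). Qed.
Let srbub k : smooth_on D (fun x => rb x * ub k x).
Proof. exact: (smoothM oD srb (sub k)). Qed.
Let sc : smooth_on D c. Proof. exact: smooth_div_x. Qed.
Let sm : smooth_on D m. Proof. exact: smooth_div_x. Qed.
Let smb : smooth_on D mb. Proof. exact: smooth_div_x. Qed.
Let smu : smooth_on D (fun x => potential r x - potential rb x).
Proof.
exact: (smoothB oD (smooth_potential sr Er) (smooth_potential srb Erb)).
Qed.

(** The sum of the contractions of div ub, grad (div ub) and grad ub with the
relative functions of s, r and H, in expanded form; relative_stressE makes the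
identification. *)
Definition relative_stress (p : P) : R :=
  div_x ub p * (r p * a p + \sum_k dx k r p * b k p
    - (rb p * X p + \sum_k dx k rb p * Y k p) - relative_density p)
  + \sum_j dx j (div_x ub) p * (r p * b j p - rb p * Y j p)
  + \sum_i \sum_j dx j (ub i) p *
      (dx i r p * b j p - dx i rb p * Y j p).

(** The three parts come from transport by ub, from integrating b . grad c by
parts, and from integrating (mu - mub) c by parts, with c = div (r w). *)
Definition internal_flux k (x : P) : R :=
  relative_density x * ub k x + c x * b k x
  + (potential r x - potential rb x) * (r x * w k x).

Lemma smooth_internal_flux k : smooth_on D (internal_flux k).
Proof.
apply: (smoothD oD (smoothD oD _ _)).
- exact: (smoothM oD smooth_relative_density (sub k)).
- exact: (smoothM oD sc (sb k)).
- exact: (smoothM oD smu (srw k)).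
Qed.

(** The continuity equations give D_t r = - (m + c) and D_t rb = - mb with
m = div (r ub), mb = div (rb ub).  By the transport identity the contributions
of m and mb cancel the stress up to the divergence of s_F ub; those of c remain. *)
Lemma internal_balance p : D p ->
  dt relative_density p + relative_stress p =
  - div_x internal_flux p
  + \sum_k (dx k (potential r) p - dx k (potential rb) p) * (r p * w k p).
Proof.
move=> Dp.
have diff (f : P -> R) : smooth_on D f -> differentiable f p.
  by move=> sf; exact: smooth_differentiable sf Dp.
have rtE x : D x -> dt r x = - (m x + c x).
  move=> Dx; rewrite (continuity Dx); congr (- _).
  have -> : (fun k (x : P) => r x * u k x) =
      (fun k (x : P) => r x * ub k x + r x * w k x).
    by apply/funext => k; apply/funext => y; rewrite /w; ring.
  by apply: div_xD => k; [exact: smooth_differentiable (srub k) Dx|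
    exact: smooth_differentiable (srw k) Dx].
have rtxE j : dt (dx j r) p = - (dx j m p + dx j c p).
  apply: etrans (derive_commute _ _ oD sr Dp) _.
  apply: etrans (derive_eq_on _ rtE Dp) _.
  apply: etrans (deriveN _) _.
    by apply: diff_derivable; apply: differentiable_add; exact: diff.
  congr (- _); exact: derive_add (diff _ sm) (diff _ sc).
have rbtxE j : dt (dx j rb) p = - dx j mb p.
  apply: etrans (derive_commute _ _ oD srb Dp) _.
  apply: etrans (derive_eq_on _ continuityb Dp) _.
  by apply: deriveN; apply: diff_derivable; exact: diff.
have T1 := transport_identity (a p) (b ^~ p) sr sub Dp.
have T2 := transport_identity (X p) (Y ^~ p) srb sub Dp.
have bal := balance_algebra (relative_density p) T1 T2 (rtE p Dp) rtxE
  (continuityb Dp) rbtxE.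
apply: etrans (etrans _ bal) _.
  by apply: (congr2 (fun x y => x + y)) => //; exact: derive_relative_density.
have drel := diff _ smooth_relative_density.
have F1 : div_x (fun k x => relative_density x * ub k x) p =
    \sum_k (a p * dx k r p + \sum_j b j p * dx k (dx j r) p
      - (X p * dx k rb p + \sum_j Y j p * dx k (dx j rb) p)) * ub k p
    + relative_density p * div_x ub p.
  apply: etrans (div_xM drel (fun k => diff _ (sub k))) _.
  apply: (congr2 (fun x y => x + y)) => //; apply: eq_bigr => k _.
  by congr (_ * _); exact: derive_relative_density.
have F2 := div_xM (diff _ sc) (fun k => diff _ (sb k)).
have F3 := div_xM (diff _ smu) (fun k => diff _ (srw k)).
have muE : potential r p - potential rb p = a p - div_x b p.
  have -> : div_x b p = div_x (fun k x => G1 k (jet r x)) p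
      - div_x (fun k x => G1 k (jet rb x)) p.
    rewrite /div_x -sumrB; apply: eq_bigr => k _.
    exact: derive_sub (diff _ (sG1r k)) (diff _ (sG1rb k)).
  have swap (x y z t : R) : x - y - (z - t) = x - z - (y - t) by ring.
  exact: swap.
have DmuE : \sum_k (dx k (potential r) p - dx k (potential rb) p)
      * (r p * w k p) =
    \sum_k dx k (fun x => potential r x - potential rb x) p * (r p * w k p).
  apply: eq_bigr => k _; congr (_ * _); symmetry.
  exact: derive_sub (diff _ (smooth_potential sr Er))
    (diff _ (smooth_potential srb Erb)).
have F : div_x internal_flux p = div_x (fun k x => relative_density x * ub k x) p
    + div_x (fun k x => c x * b k x) p
    + div_x (fun k x => (potential r x - potential rb x) * (r x * w k x)) p.
  have d1 k := diff _ (smoothM oD smooth_relative_density (sub k)).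
  have d2 k := diff _ (smoothM oD sc (sb k)).
  have d3 k := diff _ (smoothM oD smu (srw k)).
  apply: etrans (div_xD (fun k => differentiable_add (d1 k) (d2 k)) d3) _.
  apply: (congr2 (fun x y => x + y)) => //; exact: div_xD d1 d2.
have comm : \sum_k dx k c p * b k p = \sum_k b k p * dx k c p.
  by apply: eq_bigr => k _; exact: mulrC.
have F2' := etrans F2 (congr1 (fun z => z + c p * div_x b p) comm).
have F3' := etrans F3 (congr1 (fun z => _ + z * c p) muE).
have FT := etrans F (congr2 (fun y z => y + z)
  (congr2 (fun y z => y + z) F1 F2') F3').
have collect (x y B U V S z : R) :
    - (x * y + B) - (U + V) =
    - (U + V + (B + y * z) + (S + (x - z) * y)) + S by ring.
apply: etrans (esym (congr2 (fun y z => - y + z) FT DmuE)).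
exact: collect.
Qed.

Variable zeta : R.
Hypothesis momentum : forall i p, D p ->
  dt (u i) p = - (\sum_j u j p * dx j (u i) p) - dx i (potential r) p
               - zeta * u i p.
Hypothesis momentumb : forall i p, D p ->
  dt (ub i) p = - (\sum_j ub j p * dx j (ub i) p) - dx i (potential rb) p
                - zeta * ub i p.

Let Q (x : P) : R := 2^-1 * \sum_i w i x * w i x.

Definition relative_kinetic (x : P) : R := Q x * r x.

Definition kinetic_flux k (x : P) : R := Q x * (r x * u k x).

Let sQ : smooth_on D Q.
Proof.
apply: (smoothM oD (@smooth_cst _ _ _ _)).
by apply: smooth_sum => // i; exact: (smoothM oD (sw i) (sw i)).
Qed.

Lemma smooth_relative_kinetic : smooth_on D relative_kinetic.
Proof. exact: (smoothM oD sQ sr). Qed.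

Lemma smooth_kinetic_flux k : smooth_on D (kinetic_flux k).
Proof. exact: (smoothM oD sQ (smoothM oD sr (su k))). Qed.

(** The difference of the two momentum equations, tested with r w. *)
Lemma kinetic_balance p : D p ->
  dt relative_kinetic p + zeta * (r p * \sum_i w i p * w i p)
  + r p * \sum_i \sum_j dx j (ub i) p * (w i p * w j p) =
  - div_x kinetic_flux p
  - \sum_k (dx k (potential r) p - dx k (potential rb) p) * (r p * w k p).
Proof.
move=> Dp.
have diff (f : P -> R) : smooth_on D f -> differentiable f p.
  by move=> sf; exact: smooth_differentiable sf Dp.
have DwE v i : 'D_v (w i) p = 'D_v (u i) p - 'D_v (ub i) p.
  exact: derive_sub (diff _ (su i)) (diff _ (sub i)).
have DQ v : 'D_v Q p = \sum_i w i p * 'D_v (w i) p.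
  have dw2 i := differentiable_mul (diff _ (sw i)) (diff _ (sw i)).
  have Dw2 := etrans (derive_big v dw2) (eq_bigr _ (fun i _ =>
    derive_mul v (diff _ (sw i)) (diff _ (sw i)))).
  have dhalf : differentiable (fun _ : P => 2^-1 : R) p.
    exact: differentiable_cst.
  have Dhalf : 'D_v (fun _ : P => 2^-1 : R) p = 0 by exact: derive_cst.
  apply: etrans (derive_mul_eq dhalf (differentiable_big dw2) Dhalf Dw2) _.
  rewrite mul0r add0r mulr_sumr; apply: eq_bigr => i _.
  by move: ('D_v (w i) p) (w i p) => y z; field.
have E1 : dt relative_kinetic p = r p * \sum_i w i p * (dt (u i) p - dt (ub i) p)
    - Q p * div_x (fun k x => r x * u k x) p.
  apply: etrans (derive_mul_eq (diff _ sQ) (diff _ sr) (DQ _) (continuity Dp)) _.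
  apply: etrans (congr1 (fun y => y * _ + _) (eq_bigr _ (fun i _ =>
    congr1 (fun z => w i p * z) (DwE _ i)))) _.
  by rewrite mulrN mulrC.
have E2 : div_x kinetic_flux p =
    \sum_k (r p * u k p) * \sum_i w i p * (dx k (u i) p - dx k (ub i) p)
    + Q p * div_x (fun k x => r x * u k x) p.
  apply: etrans (div_xM (diff _ sQ) (fun k => diff _ (smoothM oD sr (su k)))) _.
  apply: (congr2 (fun y z => y + z)) => //; apply: eq_bigr => k _.
  apply: etrans (mulrC _ _) _; apply: (congr1 (fun z => _ * z)).
  apply: etrans (DQ _) _; apply: eq_bigr => i _.
  by apply: (congr1 (fun z => _ * z)); exact: DwE.
have K := kinetic_algebra (r p) (fun i => momentum i Dp)
  (fun i => momentumb i Dp).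
have E3 : \sum_k (dx k (potential r) p - dx k (potential rb) p)
      * (r p * w k p) =
    \sum_k r p * w k p * (dx k (potential r) p - dx k (potential rb) p).
  by apply: eq_bigr => k _; exact: mulrC.
have collect (x y z q s t : R) : x + y + z = - s - t ->
    x - q + y + z = - (s + q) - t.
  move=> h; have -> : x - q + y + z = x + y + z - q by ring.
  by rewrite h; ring.
apply: etrans (congr1 (fun x => x + _ + _) E1) _.
apply: etrans (collect _ _ _ _ _ _ K) _.
exact: esym (congr2 (fun x y => - x - y) E2 E3).
Qed.

Definition energy_flux k (x : P) : R := internal_flux k x + kinetic_flux k x.

Lemma smooth_energy_flux k : smooth_on D (energy_flux k).
Proof. exact: (smoothD oD (smooth_internal_flux k) (smooth_kinetic_flux k)). Qed.

Lemma energy_balance p : D p ->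
  dt (fun x => relative_density x + relative_kinetic x) p
  + zeta * (r p * \sum_i w i p * w i p) =
  - relative_stress p
  - r p * \sum_i \sum_j dx j (ub i) p * (w i p * w j p)
  - div_x energy_flux p.
Proof.
move=> Dp.
have diff (f : P -> R) : smooth_on D f -> differentiable f p.
  by move=> sf; exact: smooth_differentiable sf Dp.
have E1 := derive_add unit_fst (diff _ smooth_relative_density)
  (diff _ smooth_relative_kinetic).
have E2 := div_xD (fun k => diff _ (smooth_internal_flux k))
  (fun k => diff _ (smooth_kinetic_flux k)).
have I := internal_balance Dp; have K := kinetic_balance Dp.
have collect (x y z s t f g h : R) : x + s = - f + h -> y + z + t = - g - h ->
    x + y + z = - s - t - (f + g).
  move=> h1 h2; have -> : x = - f + h - s by rewrite -h1; ring.
  have -> : y = - g - h - z - t by rewrite -h2; ring.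
  by ring.
apply: etrans (congr1 (fun x => x + _) E1) _.
apply: etrans (collect _ _ _ _ _ _ _ _ I K) _.
exact: esym (congr1 (fun x => _ - x) E2).
Qed.

End TwoDensities.
End SpaceTime.

Section RelativeQuantities.
Context {R : realType} {d : nat}.

Local Notation P := (R * 'rV[R]_d)%type.
Local Notation dt f := ('D_unit_fst f).
Local Notation dx k f := ('D_(unit_snd k) f).

Variables (E : set P) (F : R -> 'rV[R]_d -> R).
Let G (y : P) := F y.1 y.2.
Hypothesis sG : smooth_on E G.

Variables (r rb : P -> R) (p : P).

Let q := (jet r p).2.
Let qb := (jet rb p).2.

Hypothesis Erb : E (rb p, qb).

Let gap : (r p - rb p, q - qb) = (r p - rb p, \row_k (dx k r p - dx k rb p)).
Proof. by congr pair; apply/rowP => k; rewrite !mxE. Qed.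

Lemma relative_densityE :
  relative F (r p) q (rb p) qb = relative_density G r rb p.
Proof.
apply: etrans (relative_expand sG (r p) q Erb) _.
apply: (congr2 (fun y z => y - z)) => //; apply: (congr2 (fun y z => y + z)) => //; apply: eq_bigr => k _.
by apply: (congr2 (fun y z => y * z)) => //; rewrite !mxE.
Qed.

Lemma relative_stressE (ub : 'I_d -> P -> R) :
  div_x ub p * relative (s_fun F) (r p) q (rb p) qb
  + \sum_j dx j (div_x ub) p * relative_vec (r_fun F) (r p) q (rb p) qb 0 j
  + \sum_i \sum_j dx j (ub i) p
      * relative_mx (H_fun F) (r p) q (rb p) qb i j =
  relative_stress G r rb ub p.
Proof.
have rowE (f : 'I_d -> R) k : (\row_k f k : 'rV[R]_d) 0 k = f k by exact: mxE.
have sE := relative_s_expand sG (r p) q Erb.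
have rE j := relative_r_expand sG (r p) q Erb j.
have hE i j := relative_H_expand sG (r p) q Erb i j.
rewrite gap relative_densityE in sE; rewrite gap in rE hE.
apply: (congr2 (fun y z => y + z)).
  apply: (congr2 (fun y z => y + z)).
    apply: (congr2 (fun y z => y * z)) => //; apply: (etrans sE).
    apply: (congr2 (fun y z => y - z)) => //; apply: (congr2 (fun y z => y - z)).
      apply: (congr2 (fun y z => y + z)) => //; apply: eq_bigr => k _.
      by apply: (congr2 (fun y z => y * z)) => //; exact: rowE.
    apply: (congr2 (fun y z => y + z)) => //; apply: eq_bigr => k _.
    by apply: (congr2 (fun y z => y * z)) => //; exact: rowE.
  by apply: eq_bigr => j _; apply: (congr2 (fun y z => y * z)) => //; exact: rE.
apply: eq_bigr => i _; apply: eq_bigr => j _; apply: (congr1 (fun z => _ * z)).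
apply: (etrans (hE i j)); apply: (congr2 (fun y z => y - z)).
  by apply: (congr2 (fun y z => y * z)) => //; exact: rowE.
by apply: (congr2 (fun y z => y * z)) => //; exact: rowE.
Qed.

End RelativeQuantities.

(** * Integration of the balance law over the torus *)

Section Slices.
Context {R : realType} {d : nat}.

Local Notation P := (R * 'rV[R]_d)%type.
Local Notation dt f := ('D_unit_fst f).
Local Notation dx k f := ('D_(unit_snd k) f).

Section Periodic.
Variable I : set R.

Lemma x_periodic2 (T U W : Type) (op : T -> U -> W) (f : P -> T) (g : P -> U) :
  x_periodic I f -> x_periodic I g -> x_periodic I (fun p => op (f p) (g p)).
Proof. by move=> pf pg t It i x; rewrite (pf t It i x) (pg t It i x). Qed.

Lemma x_periodic_comp (T W : Type) (h : T -> W) (f : P -> T) :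
  x_periodic I f -> x_periodic I (fun p => h (f p)).
Proof. by move=> pf t It i x; rewrite (pf t It i x). Qed.

Lemma x_periodic_sum n (f : 'I_n -> P -> R) : (forall k, x_periodic I (f k)) ->
  x_periodic I (fun p => \sum_k f k p).
Proof. by move=> pf t It i x; apply: eq_bigr => k _; exact: pf. Qed.

Lemma x_periodic_div_x (v : 'I_d -> P -> R) : (forall k, x_periodic I (v k)) ->
  x_periodic I (div_x v).
Proof. by move=> pv; apply: x_periodic_sum => k; exact: x_periodic_derive. Qed.

Lemma x_periodic_jet (r : P -> R) : x_periodic I r -> x_periodic I (jet r).
Proof.
move=> pr t It i x; rewrite /jet /tuple_map; congr pair; first exact: pr.
by apply/rowP => k; rewrite !mxE; exact: (x_periodic_derive k pr It).
Qed.

Lemma x_periodic_energy_flux (G r rb : P -> R) (u ub : 'I_d -> P -> R) k :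
  x_periodic I r -> x_periodic I rb ->
  (forall i, x_periodic I (u i)) -> (forall i, x_periodic I (ub i)) ->
  x_periodic I (energy_flux G r rb u ub k).
Proof.
move=> pr prb pu pub.
have pG (H s : P -> R) : x_periodic I s -> x_periodic I (fun p => H (jet s p)).
  by move=> ps; exact: (x_periodic_comp H (x_periodic_jet ps)).
have pmul (f g : P -> R) : x_periodic I f -> x_periodic I g ->
  x_periodic I (fun p => f p * g p) by exact: x_periodic2.
have padd (f g : P -> R) : x_periodic I f -> x_periodic I g ->
  x_periodic I (fun p => f p + g p) by exact: x_periodic2.
have psub (f g : P -> R) : x_periodic I f -> x_periodic I g ->
  x_periodic I (fun p => f p - g p).
  exact: (@x_periodic2 _ _ _ (fun y z : R => y - z)).
have pw i := psub _ _ (pu i) (pub i).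
have pdr j := psub _ _ (x_periodic_derive j pr) (x_periodic_derive j prb).
have plin j := pmul _ _ (pdr j) (pG (dx j G) rb prb).
have prel : x_periodic I (relative_density G r rb).
  exact: (psub _ _ (psub _ _ (pG G r pr) (pG G rb prb))
    (padd _ _ (pmul _ _ (psub _ _ pr prb) (pG (dt G) rb prb))
      (x_periodic_sum plin))).
have ppot (s : P -> R) : x_periodic I s -> x_periodic I (potential G s).
  move=> ps.
  exact: (psub _ _ (pG (dt G) s ps)
    (x_periodic_div_x (fun j => pG (dx j G) s ps))).
have pc := x_periodic_div_x (fun j => pmul _ _ pr (pw j)).
have pb := psub _ _ (pG (dx k G) r pr) (pG (dx k G) rb prb).
have pmu := psub _ _ (ppot r pr) (ppot rb prb).
have pQ := x_periodic_comp (fun y : R => 2^-1 * y)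
  (x_periodic_sum (fun i => pmul _ _ (pw i) (pw i))).
exact: (padd _ _ (padd _ _ (padd _ _ (pmul _ _ prel (pub k)) (pmul _ _ pc pb))
  (pmul _ _ pmu (pmul _ _ pr (pw k)))) (pmul _ _ pQ (pmul _ _ pr (pu k)))).
Qed.

End Periodic.

(** Space-time smoothness holds on an open set of times only, hence the restriction
to a fixed admissible time. *)
Lemma slice_continuous (I : set R) (f : P -> R) t :
  smooth_on [set p : P | I p.1] f -> I t -> continuous (fun x => f (t, x)).
Proof.
move=> sf It x.
apply: (continuous_curry_pt (f := fun t x => f (t, x))) => y.
have -> : (fun z : P => f (z.1, z.2)) = f by apply/funext => -[].
exact/differentiable_continuous/(smooth_differentiable sf).
Qed.

Lemma torus_integral_time_derivative (I : set R) (f : P -> R) t :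
  open I -> smooth_on [set p : P | I p.1] f -> I t ->
  is_derive t 1 (fun s => torus_integral (fun x => f (s, x)))
    (torus_integral (fun x => dt f (t, x))).
Proof.
move=> oI sf It.
have joint (g : P -> R) s x : smooth_on [set p : P | I p.1] g -> I s ->
    {for (s, x), continuous (fun z : P => g (z.1, z.2))}.
  move=> sg Is; have -> : (fun z : P => g (z.1, z.2)) = g.
    by apply/funext => -[].
  exact/differentiable_continuous/(smooth_differentiable sg).
have df s y : I s -> is_derive s 1 (fun s => f (s, y)) (dt f (s, y)).
  by move=> Is; apply: is_derive_slice; apply: (smooth_differentiable sf).
exact: (torus_integral_derive (f := fun s x => f (s, x))
  (df := fun s x => dt f (s, x)) oI df (fun s x => joint f s x sf)
  (fun s x => joint (dt f) s x (smooth_derive _ sf)) It).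
Qed.

Lemma torus_integral_div_x (I : set R) (v : 'I_d -> P -> R) t :
  (forall k, smooth_on [set p : P | I p.1] (v k)) ->
  (forall k, x_periodic I (v k)) -> I t ->
  torus_integral (fun x => div_x v (t, x)) = 0.
Proof.
move=> sv pv It.
have partialE k : partial k (fun x => v k (t, x)) = (fun x => dx k (v k) (t, x)).
  apply/funext => x; rewrite (partial_slice (fun t x => v k (t, x))).
  by congr (derive _ _ _); apply/funext => -[].
have cdx k : continuous (fun x => dx k (v k) (t, x)).
  exact: slice_continuous (smooth_derive _ (sv k)) It.
rewrite torus_integral_sum// big1// => k _; rewrite -partialE.
apply: torus_integral_partial.
- exact: pv.
- exact: slice_continuous (sv k) It.
- by move=> x; apply: derivable_slice; apply: (smooth_differentiable (sv k)).
- by rewrite partialE.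
Qed.

End Slices.

(** * Solutions in space-time variables *)

Section Translation.
Context {R : realType} {d : nat}.

Local Notation P := (R * 'rV[R]_d)%type.
Local Notation dt f := ('D_unit_fst f).
Local Notation dx k f := ('D_(unit_snd k) f).

Variables (zeta : R) (F : R -> 'rV[R]_d -> R) (I : set R).
Variables (rho : R -> 'rV[R]_d -> R) (u : R -> 'rV[R]_d -> 'rV[R]_d).
Hypotheses (oI : open I) (sol : EK_solution zeta F I rho u).

Let D : set P := [set p | I p.1].
Let G (y : P) := F y.1 y.2.
Let r (p : P) := rho p.1 p.2.
Let v i (p : P) : R := u p.1 p.2 0 i.

Let oD : open D.
Proof. by apply: open_comp => // p _; exact: (@continuous_fst _ _ p). Qed.

(** A spatial derivative at fixed time and the corresponding space-time derivative
are limits of the same quotient. *)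
Lemma uncurry_derive k (f : P -> R) t x :
  partial k (fun y => f (t, y)) x = dx k f (t, x).
Proof.
rewrite (partial_slice (fun t x => f (t, x))).
by congr (derive _ _ _); apply/funext => -[].
Qed.

Lemma gradE (f : 'rV[R]_d -> R) x k : grad f x 0 k = partial k f x.
Proof. by rewrite mxE. Qed.

Lemma solution_smooth_density : smooth_on D r.
Proof. exact: EK_rho_smooth sol. Qed.

Lemma solution_smooth_velocity i : smooth_on D (v i).
Proof. exact: (smooth_entry i oD (EK_u_smooth sol)). Qed.

Lemma solution_jet p : jet r p = (rho p.1 p.2, grad (rho p.1) p.2).
Proof.
case: p => t x; congr pair; apply/rowP => k; rewrite !mxE.
by rewrite -uncurry_derive.
Qed.

Lemma solution_div t x : divergence (u t) x = div_x v (t, x).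
Proof. by apply: eq_bigr => k _; rewrite -uncurry_derive. Qed.

Lemma solution_continuity p : D p ->
  dt r p = - div_x (fun k x => r x * v k x) p.
Proof.
case: p => t x It; have := EK_continuity sol x It.
rewrite (derive1_slice rho) => /eqP; rewrite addr_eq0 => /eqP ->; congr (- _).
apply: eq_bigr => k _.
have fE : (fun y => (rho t y *: u t y) 0 k) = (fun y => r (t, y) * v k (t, y)).
  by apply/funext => y; rewrite mxE.
exact: etrans (congr1 (fun f => partial k f x) fE)
  (uncurry_derive k (fun p => r p * v k p) t x).
Qed.

Lemma solution_potential t x :
  chemical_potential F (rho t) x = potential G r (t, x).
Proof.
rewrite /chemical_potential /potential D_rhoE solution_jet; congr (_ - _).
apply: eq_bigr => k _.
have fE : (fun y => D_q F (rho t y) (grad (rho t) y) 0 k) =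
    (fun y => dx k G (jet r (t, y))).
  apply/funext => y; rewrite solution_jet.
  exact: etrans (gradE _ _ _) (partial_slice F _ _ _).
have U : partial k (fun y => dx k G (jet r (t, y))) x =
    dx k (fun p => dx k G (jet r p)) (t, x).
  exact: uncurry_derive.
apply: etrans U.
apply: (congr1 (fun f => partial k f x)).
exact: fE.
Qed.

(** The momentum equation may be divided by the density, which is positive. *)
Lemma solution_momentum i p : D p ->
  dt (v i) p = - (\sum_j v j p * dx j (v i) p) - dx i (potential G r) p
               - zeta * v i p.
Proof.
case: p => t x It.
have rho_neq0 : rho t x != 0 by rewrite gt_eqF// (EK_rho_gt0 sol).
have vtE : derive1 (u ^~ x) t 0 i = dt (v i) (t, x).
  rewrite (derive1_slice u) derive_entry//.
  exact: smooth_differentiable (EK_u_smooth sol) It.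
have advE : advection (u t) (u t) x 0 i = \sum_j v j (t, x) * dx j (v i) (t, x).
  apply: etrans (mxE _ _ _ _) _; apply: eq_bigr => j _.
  by congr (_ * _); exact: (uncurry_derive j (v i) t x).
have potE : grad (chemical_potential F (rho t)) x 0 i =
    dx i (potential G r) (t, x).
  have muE : chemical_potential F (rho t) = (fun y => potential G r (t, y)).
    by apply/funext => y; exact: solution_potential.
  apply: etrans (congr1 (fun f => grad f x 0 i) muE) _.
  exact: etrans (gradE _ _ _) (uncurry_derive i (potential G r) t x).
have M := congr1 (fun z : 'rV[R]_d => z 0 i) (EK_momentum sol x It).
have {}M : rho t x * (dt (v i) (t, x) + \sum_j v j (t, x) * dx j (v i) (t, x)) =
    rho t x * (- dx i (potential G r) (t, x) - zeta * u t x 0 i).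
  have entE (a b c : 'rV[R]_d) (s z : R) :
      (s *: (a + b)) 0 i = (- (s *: c) - (z * s) *: u t x) 0 i ->
      s * (a 0 i + b 0 i) = s * (- c 0 i - z * u t x 0 i).
    by rewrite !mxE => ->; ring.
  by have := entE _ _ _ _ _ M; rewrite vtE advE potE.
move/(mulfI rho_neq0): M => M.
have solve (a b c e : R) : a + b = - c - e -> a = - b - c - e.
  by move=> h; rewrite -[LHS](addrK b) h; ring.
exact: solve M.
Qed.

Lemma solution_jet_gt0 p : D p -> 0 < (jet r p).1.
Proof. by case: p => t x It; exact: (EK_rho_gt0 sol x It). Qed.

Lemma solution_periodic_density : x_periodic I r.
Proof. by move=> t It; exact: (EK_rho_periodic sol It). Qed.

Lemma solution_periodic_velocity i : x_periodic I (v i).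
Proof.
by move=> t It k x; rewrite /v/= (EK_u_periodic sol It).
Qed.

End Translation.

(** * The relative energy identity *)

Lemma dot_sumE (R : realType) d (a b : 'rV[R]_d) :
  dot (a - b) (a - b) =
  \sum_i (a 0 i - b 0 i) * (a 0 i - b 0 i).
Proof. by apply: eq_bigr => i _; rewrite !mxE. Qed.

Theorem mainTheorem7 (R : realType) (d : nat) (zeta : R)
    (F : R -> 'rV[R]_d -> R) (I : set R)
    (rho rhob : R -> 'rV[R]_d -> R) (u ub : R -> 'rV[R]_d -> 'rV[R]_d) :
  0 <= zeta ->
  smooth_on [set p : R * 'rV[R]_d | 0 < p.1] (fun p => F p.1 p.2) ->
  open I -> is_interval I ->
  EK_solution zeta F I rho u ->
  EK_solution zeta F I rhob ub ->
  let rel_energy (t : R) : R :=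
    torus_integral (fun x =>
      relative F (rho t x) (grad (rho t) x) (rhob t x) (grad (rhob t) x)
      + 2^-1 * rho t x * dot (u t x - ub t x) (u t x - ub t x)) in
  forall t : R, I t ->
    derivable rel_energy t 1 /\
    derive1 rel_energy t
      + zeta * torus_integral (fun x =>
          rho t x * dot (u t x - ub t x) (u t x - ub t x))
    = - torus_integral (fun x =>
          divergence (ub t) x
            * relative (s_fun F)
                (rho t x) (grad (rho t) x) (rhob t x) (grad (rhob t) x)
          + dot (grad (divergence (ub t)) x)
              (relative_vec (r_fun F)
                (rho t x) (grad (rho t) x) (rhob t x) (grad (rhob t) x))
          + frob (grad_vec (ub t) x)
              (relative_mx (H_fun F)
                (rho t x) (grad (rho t) x) (rhob t x) (grad (rhob t) x)))
      - torus_integral (fun x =>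
          rho t x * frob (grad_vec (ub t) x)
                      (outer (u t x - ub t x) (u t x - ub t x))).
Proof.
move=> _ sF oI _ sol solb rel_energy t It.
pose P := (R * 'rV[R]_d)%type.
pose D : set P := [set p | I p.1].
pose E : set P := [set p | 0 < p.1].
pose G (p : P) := F p.1 p.2.
pose r (p : P) := rho p.1 p.2.
pose rb (p : P) := rhob p.1 p.2.
pose v i (p : P) : R := u p.1 p.2 0 i.
pose vb i (p : P) : R := ub p.1 p.2 0 i.
have oD : open D by apply: open_comp => // p _; exact: (@continuous_fst _ _ p).
have oE : open E.
  apply: (@open_comp P R fst [set x : R | 0 < x]); last exact: open_gt.
  by move=> p _; exact: (@continuous_fst _ _ p).
have sr := solution_smooth_density sol.
have srb := solution_smooth_density solb.
have sv := solution_smooth_velocity oI sol.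
have svb := solution_smooth_velocity oI solb.
have Er p : D p -> E (jet r p) by move=> Dp; exact: (solution_jet_gt0 sol Dp).
have Erb p : D p -> E (jet rb p) by move=> Dp; exact: (solution_jet_gt0 solb Dp).
pose rel : P -> R := relative_density G r rb.
pose kin : P -> R := relative_kinetic r v vb.
pose e (p : P) : R := rel p + kin p.
have se : smooth_on D e.
  exact: (smoothD oD (smooth_relative_density oD sF sr srb Er Erb)
    (smooth_relative_kinetic oD sr sv svb)).
pose sq (p : P) : R := r p * \sum_i (v i p - vb i p) * (v i p - vb i p).
pose strain (p : P) : R := r p * \sum_i \sum_j 'D_(unit_snd j) (vb i) p *
  ((v i p - vb i p) * (v j p - vb j p)).
pose flux := energy_flux G r rb v vb.
pose st : P -> R := relative_stress G r rb vb.
have balance p : D p ->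
    'D_unit_fst e p + zeta * sq p = - st p - strain p - div_x flux p.
  move=> Dp.
  exact: (energy_balance oD oE sF sr srb Er Erb sv svb
    (solution_continuity sol) (solution_continuity solb)
    (solution_momentum sol) (solution_momentum solb) Dp).
have qE s x : (jet r (s, x)).2 = grad (rho s) x.
  exact: (congr1 (fun p : P => p.2) (solution_jet rho (s, x))).
have qbE s x : (jet rb (s, x)).2 = grad (rhob s) x.
  exact: (congr1 (fun p : P => p.2) (solution_jet rhob (s, x))).
have energyE s x : I s ->
    relative F (rho s x) (grad (rho s) x) (rhob s x) (grad (rhob s) x)
      + 2^-1 * rho s x * dot (u s x - ub s x) (u s x - ub s x) = e (s, x).
  move=> Is; apply: (congr2 (fun y z => y + z)).
    rewrite -(qE s x) -(qbE s x).
    exact: (relative_densityE sF r (Erb (s, x) Is)).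
  rewrite dot_sumE; have mulAC (y z w : R) : y * z * w = y * w * z by ring.
  exact: mulAC.
have sqE x : rho t x * dot (u t x - ub t x) (u t x - ub t x) = sq (t, x).
  by rewrite dot_sumE.
have gradE_vec i j x : grad_vec (ub t) x i j = 'D_(unit_snd j) (vb i) (t, x).
  exact: etrans (mxE _ _ _ _) (uncurry_derive j (vb i) t x).
have strainE x : rho t x * frob (grad_vec (ub t) x)
    (outer (u t x - ub t x) (u t x - ub t x)) = strain (t, x).
  apply: (congr2 (fun y z => y * z)) => //.
  apply: eq_bigr => i _; apply: eq_bigr => j _.
  apply: (congr2 (fun y z => y * z)); first exact: gradE_vec.
  by rewrite !mxE.
have stressE x : divergence (ub t) x * relative (s_fun F)
        (rho t x) (grad (rho t) x) (rhob t x) (grad (rhob t) x)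
    + dot (grad (divergence (ub t)) x) (relative_vec (r_fun F)
        (rho t x) (grad (rho t) x) (rhob t x) (grad (rhob t) x))
    + frob (grad_vec (ub t) x) (relative_mx (H_fun F)
        (rho t x) (grad (rho t) x) (rhob t x) (grad (rhob t) x)) = st (t, x).
  rewrite -(qE t x) -(qbE t x).
  apply: etrans (relative_stressE sF r (Erb (t, x) It) vb).
  apply: (congr2 (fun y z => y + z)); first apply: (congr2 (fun y z => y + z)).
  - by apply: (congr2 (fun y z => y * z)) => //; exact: solution_div.
  - apply: eq_bigr => j _; apply: (congr2 (fun y z => y * z)) => //.
    apply: etrans (gradE _ _ _) _.
    have divE : divergence (ub t) = (fun y => div_x vb (t, y)).
      by apply/funext => y; exact: solution_div.
    apply: etrans (congr1 (fun f => partial j f x) divE) _.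
    exact: uncurry_derive.
  - apply: eq_bigr => i _; apply: eq_bigr => j _.
    by apply: (congr2 (fun y z => y * z)) => //; exact: gradE_vec.
have dT := torus_integral_time_derivative oI se It.
(* The expansion of the relative energy needs positive densities, so it is
   available at times of I only: near t, since I is open. *)
have near_energy : \near t, torus_integral (fun x => e (t, x)) = rel_energy t.
  apply: filterS (open_nbhs_nbhs (conj oI It)) => s Is.
  by congr torus_integral; apply/funext => x; rewrite energyE.
have drel := near_eq_is_derive near_energy dT.
split; first exact: ex_derive.
have -> : derive1 rel_energy t = torus_integral (fun x => 'D_unit_fst e (t, x)).
  by rewrite derive1E; exact: derive_val.
have sstrain : smooth_on D strain.
  apply: (smoothM oD sr); apply: smooth_sum => // i; apply: smooth_sum => // j.
  apply: (smoothM oD (smooth_derive _ (svb i))).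
  exact: (smoothM oD (smoothB oD (sv i) (svb i)) (smoothB oD (sv j) (svb j))).
have ssq : smooth_on D sq.
  apply: (smoothM oD sr); apply: smooth_sum => // i.
  exact: (smoothM oD (smoothB oD (sv i) (svb i)) (smoothB oD (sv i) (svb i))).
have sflux k : smooth_on D (flux k).
  exact: (smooth_energy_flux oD sF sr srb Er Erb sv svb).
have cslice (f : P -> R) : smooth_on D f -> continuous (fun x => f (t, x)).
  by move=> sf; exact: slice_continuous sf It.
have c1 := cslice _ (smooth_derive unit_fst se).
have c2 := cslice _ ssq.
have c3 := cslice _ sstrain.
have c4 := cslice _ (smooth_div_x oD sflux).
have c2z := continuous_scale (c := zeta) c2.
have flux0 : torus_integral (fun x => div_x flux (t, x)) = 0.
  apply: (torus_integral_div_x sflux _ It) => k.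
  apply: x_periodic_energy_flux.
  - exact: solution_periodic_density sol.
  - exact: solution_periodic_density solb.
  - exact: solution_periodic_velocity sol.
  - exact: solution_periodic_velocity solb.
(* The balance law solved for the stress, integrated over the torus. *)
have stE : torus_integral (fun x => st (t, x)) =
    - (torus_integral (fun x => 'D_unit_fst e (t, x))
       + zeta * torus_integral (fun x => sq (t, x))
       + (torus_integral (fun x => strain (t, x)) + 0)).
  have stE x : st (t, x) = -1 * ('D_unit_fst e (t, x) + zeta * sq (t, x)
      + (strain (t, x) + div_x flux (t, x))).
    have solve (y z w s : R) : y = - s - z - w -> s = -1 * (y + (z + w)).
      by move=> ->; ring.
    exact: solve (balance (t, x) It).
  have c12 := continuous_add c1 c2z.
  have c34 := continuous_add c3 c4.
  apply: etrans (congr1 torus_integral (funext stE)) _.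
  apply: etrans (torus_integralZ _ (continuous_add c12 c34)) _.
  apply: etrans (mulN1r _) _; congr (- _).
  apply: etrans (torus_integralD c12 c34) _; apply: (congr2 (fun y z => y + z)).
    apply: etrans (torus_integralD c1 c2z) _.
    by apply: (congr2 (fun y z => y + z)) => //; exact: torus_integralZ.
  apply: etrans (torus_integralD c3 c4) _.
  by apply: (congr2 (fun y z => y + z)).
have collect (x y z s : R) : s = - (x + y + (z + 0)) -> x + y = - s - z.
  by move=> ->; ring.
apply: etrans (congr1 (fun f => _ + zeta * torus_integral f) (funext sqE)) _.
apply: etrans (collect _ _ _ _ stE) _; symmetry.
exact: (congr2 (fun f g => - torus_integral f - torus_integral g)
  (funext stressE) (funext strainE)).
Qed.
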